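(* Let $K$ be a field, let $S_1=K[x_1,\dots,x_n]$ and $S_2=K[y_1,\dots,y_m]$ be polynomial rings in disjoint sets of variables, and let $S=K[x_1,\dots,x_n,y_1,\dots,y_m]$. Let $I_1\subset S_1$ and $I_2\subset S_2$ be squarefree monomial ideals, and let $I_1I_2\subset S$ denote the product of the ideals generated by $I_1$ and $I_2$ in $S$. Then $\nu(I_1I_2)=\min\{\nu(I_1),\nu(I_2)\}$, and for all $1\le k\le\nu(I_1I_2)$, $$g_{I_1I_2}(k)=g_{I_1}(k)+g_{I_2}(k).$$
   Context: All squarefree monomial ideals are nonzero and proper. For a squarefree monomial ideal $I$ in a polynomial ring $T$ over $K$, the $k$th squarefree power $I^{[k]}$ is the monomial ideal of $T$ generated by the squarefree monomials belonging to $I^k$. The monomial grade $\nu(I)$ is the biggest length of a monomial regular sequence contained in $I$; equivalently $I^{[k]}\neq(0)$ if and only if $k\le\nu(I)$. For $1\le k\le \nu(I)$, $d_k=\mathrm{indeg}(I^{[k]})$ is the minimum degree of a monomial generator of $I^{[k]}$, and the normalized depth function of $I$ is $g_I(k)=\mathrm{depth}(T/I^{[k]})-(d_k-1)$ for $1\le k\le\nu(I)$. By convention the ambient polynomial ring $T$ is the smallest polynomial ring over $K$ containing the minimal monomial generators of $I$ (every variable divides some minimal generator); here $g_{I_1}$, $g_{I_2}$, $g_{I_1I_2}$ are computed in $S_1$, $S_2$, $S$, respectively. *)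

(* Defs.v *)
From mathcomp Require Import all_boot all_order all_algebra.
From mathcomp Require Import boolp classical_sets.
From mathcomp Require Import mpoly.

Set Implicit Arguments.
Unset Strict Implicit.
Unset Printing Implicit Defensive.

Import GRing.Theory.
Local Open Scope classical_set_scope.
Local Open Scope ring_scope.

(* Largest and least elements of a set of natural numbers; the value is 0 by
   default when there is no such element. *)
Definition nat_max (A : set nat) : nat :=
  xget 0%N [set d | A d /\ forall e, A e -> (e <= d)%N].
Definition nat_min (A : set nat) : nat :=
  xget 0%N [set d | A d /\ forall e, A e -> (d <= e)%N].

Section Ideals.
Variable R : comNzRingType.

(* Not necessarily proper, unlike [idealr_closed]. *)
Definition is_ideal (I : set R) : Prop :=
  [/\ I 0, (forall f g, I f -> I g -> I (f + g))
    & (forall f g, I g -> I (f * g))].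

Definition ideal_gen (A : set R) : set R := smallest is_ideal A.

Definition ideal_mul (I J : set R) : set R :=
  ideal_gen [set f * g | f in I & g in J].

Fixpoint ideal_pow (I : set R) (k : nat) : set R :=
  if k is k'.+1 then ideal_mul I (ideal_pow I k') else [set: R].

(* [s] is a regular sequence on the module R / J: each term is a nonzerodivisor
   modulo J and the preceding terms, and (R / J) / s (R / J) is nonzero. *)
Definition regular_seq (J : set R) (s : seq R) : Prop :=
  (forall i, (i < size s)%N ->
     forall f, ideal_gen (J `|` [set` take i s]) (s`_i * f) ->
               ideal_gen (J `|` [set` take i s]) f)
  /\ ~ ideal_gen (J `|` [set` s]) 1.

End Ideals.

Section MonomialIdeals.
Variables (K : fieldType) (n : nat).
Notation T := {mpoly K[n]}.

(* The graded maximal ideal (x_1, ..., x_n). *)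
Definition max_ideal : set T := ideal_gen (range (fun i : 'I_n => 'X_i)).

(* depth (T / J) with respect to the graded maximal ideal. *)
Definition depth_quot (J : set T) : nat :=
  nat_max [set r | exists s : seq T,
    [/\ size s = r, (forall f, f \in s -> max_ideal f) & regular_seq J s]].

Definition squarefree (u : 'X_{1..n}) : Prop := forall i, (u i <= 1)%N.

Definition monomial_gen (M : set 'X_{1..n}) : set T :=
  ideal_gen [set 'X_[u] | u in M].

Definition squarefree_monomial_ideal (I : set T) : Prop :=
  [/\ exists2 M : set 'X_{1..n},
        (forall u, M u -> squarefree u) & I = monomial_gen M,
      I <> [set 0] & I <> [set: T]].

(* Minimal monomial generators: [(v <= u)%MM] is divisibility of monomials. *)
Definition min_gen (I : set T) : set 'X_{1..n} :=
  [set u | I 'X_[u] /\ forall v, I 'X_[v] -> (v <= u)%MM -> v = u].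

(* The ambient ring is the smallest one containing the minimal generators. *)
Definition full_support (I : set T) : Prop :=
  forall i : 'I_n, exists2 u, min_gen I u & (0 < u i)%N.

Definition sqfree_pow (I : set T) (k : nat) : set T :=
  monomial_gen [set u | squarefree u /\ ideal_pow I k 'X_[u]].

Definition monomial_grade (I : set T) : nat :=
  nat_max [set r | exists us : seq 'X_{1..n},
    [/\ size us = r, (forall u, u \in us -> I 'X_[u])
      & regular_seq [set 0] [seq ('X_[u] : T) | u <- us]]].

Definition indeg (J : set T) : nat := nat_min [set mdeg u | u in min_gen J].

Definition norm_depth (I : set T) (k : nat) : int :=
  (depth_quot (sqfree_pow I k))%:Z - ((indeg (sqfree_pow I k))%:Z - 1).

End MonomialIdeals.

Section DisjointProduct.
Variables (K : fieldType) (n m : nat).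

(* In {mpoly K[n + m]} the first n variables are the x_i, the last m the y_j. *)
Definition embed_x (f : {mpoly K[n]}) : {mpoly K[n + m]} :=
  comp_mpoly [tuple 'X_(lshift m i) | i < n] f.
Definition embed_y (f : {mpoly K[m]}) : {mpoly K[n + m]} :=
  comp_mpoly [tuple 'X_(rshift n j) | j < m] f.

Definition disjoint_mul (I1 : set {mpoly K[n]}) (I2 : set {mpoly K[m]}) :
    set {mpoly K[n + m]} :=
  ideal_mul (ideal_gen (embed_x @` I1)) (ideal_gen (embed_y @` I2)).

End DisjointProduct.

(* Main.v *)
From HB Require Import structures.
Require Import Defs.
From mathcomp Require Import all_boot all_order all_algebra.
From mathcomp Require Import boolp classical_sets.
From mathcomp Require Import ssrcomplements mpoly.
From mathcomp Require Import ring.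

Set Implicit Arguments.
Unset Strict Implicit.
Unset Printing Implicit Defensive.

Import Order.TTheory GRing.Theory.
Local Open Scope classical_set_scope.
Local Open Scope ring_scope.

(** Why the theorem holds.  A monomial lies in [(I1 I2)^k] exactly when its
    x-part lies in [I1^k] and its y-part in [I2^k] (lemma [powm_prod]), so the
    extensions to [S] of [J1 = I1^[k]] and [J2 = I2^[k]] intersect in
    [(I1 I2)^[k]].  Three consequences follow.

    - The squarefree power [I^[k]] is nonzero exactly when [I] contains [k]
      pairwise coprime monomials, and these are the monomial regular sequences
      of length [k] in [I] ([monomial_gradeP]).  Nonvanishing for [I1 I2] means
      nonvanishing for both factors, so the grade is the minimum.
    - Initial degrees add ([indeg_prodm]).
    - With [d1 = depth S1/J1] and [d2 = depth S2/J2], the exact sequence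
      [0 -> S/(J1 cap J2) -> S/J1 (+) S/J2 -> S/(J1 + J2) -> 0] has a last term
      of depth [d1 + d2], since it is the tensor product of [S1/J1] and [S2/J2]
      over [K], and a middle term whose summands have depths [d1 + m] and
      [n + d2].  As [J1] and [J2] are nonzero, [d1 < n] and [d2 < m]; the middle
      term is therefore deeper than the last one, and the first term has depth
      [d1 + d2 + 1] ([depth_prodm]).

    Subtracting [indeg - 1] on both sides gives the formula for the normalized
    depth functions.

    The facts about depth are obtained without homological algebra, from the
    recursive predicate [depth_is m r J]: some [r] elements of [m] form a regular
    sequence on [R/J] after which [m] annihilates a nonzero class.  Over a
    Noetherian ring, finitely many modules [R/J] whose socle is zero have a
    common nonzerodivisor in [m] ([common_nzd], by prime avoidance).  With such
    an element any two regular sequences can be compared ([depth_is_adj]), so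
    that [r] is the length of every maximal regular sequence; and the depth of an
    intersection is found by dividing out common nonzerodivisors until
    [R/(I + J)] has a socle ([depth_setI]).  The depth of a tensor product comes
    from coordinates with respect to a complement of an ideal in the polynomial
    ring ([ext_coords], [depth_tensor]).  The strict inequality [d < n] is a
    dimension count: powers of a regular sequence of length [n], together with
    powers of a nonzero element of the ideal, would yield more linearly
    independent polynomials of bounded degree than there are monomials
    ([depth_lt_dim]). *)

(** * Ideals as sets *)

Section IdealTheory.
Variable R : comNzRingType.
Implicit Types (I J L : set R) (s : seq R).

Lemma ideal0 I : is_ideal I -> I 0. Proof. by case. Qed.
Lemma idealD I f g : is_ideal I -> I f -> I g -> I (f + g).
Proof. by case=> _ + _; apply. Qed.
Lemma ideal_mull I f g : is_ideal I -> I g -> I (f * g).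
Proof. by case=> _ _; apply. Qed.
Lemma ideal_mulr I f g : is_ideal I -> I f -> I (f * g).
Proof. by rewrite mulrC; apply: ideal_mull. Qed.
Lemma idealN I f : is_ideal I -> I f -> I (- f).
Proof. by move=> iI If; rewrite -mulN1r; apply: ideal_mull. Qed.
Lemma idealB I f g : is_ideal I -> I f -> I g -> I (f - g).
Proof. by move=> iI If Ig; apply: idealD => //; apply: idealN. Qed.
Lemma ideal_sum I (T : Type) (r : seq T) (P : pred T) (F : T -> R) :
  is_ideal I -> (forall i, P i -> I (F i)) -> I (\sum_(i <- r | P i) F i).
Proof.
move=> iI IF; elim/big_ind: _ => //; first exact: ideal0.
by move=> *; apply: idealD.
Qed.
Lemma zero_ideal : is_ideal [set 0 : R].
Proof. by split=> //= [f g -> ->|f g ->]; rewrite ?addr0 ?mulr0. Qed.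

Lemma idealDl I f g : is_ideal I -> I f -> I (f + g) -> I g.
Proof.
move=> iI If Ifg; have -> : g = (f + g) - f by ring.
exact: idealB.
Qed.

Lemma is_ideal_gen (A : set R) : is_ideal (ideal_gen A).
Proof.
split=> [|f g If Ig|f g Ig] I [iI AI]; first exact: ideal0.
  by apply: idealD => //; [apply: If | apply: Ig].
by apply: ideal_mull => //; apply: Ig.
Qed.

Lemma mem_ideal_gen (A : set R) f : A f -> ideal_gen A f.
Proof. exact: sub_gen_smallest. Qed.

Lemma gen_sub (A : set R) I : is_ideal I -> A `<=` I -> ideal_gen A `<=` I.
Proof. exact: smallest_sub. Qed.

Lemma gen_mono (A B : set R) : A `<=` B -> ideal_gen A `<=` ideal_gen B.
Proof. by move=> AB; apply: gen_sub (is_ideal_gen B) _ => f /AB /mem_ideal_gen. Qed.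

Lemma gen_id I : is_ideal I -> ideal_gen I = I.
Proof. exact: smallest_id. Qed.

Definition adj J z : set R := [set p | exists j a, J j /\ p = j + z * a].

Lemma adj_ideal J z : is_ideal J -> is_ideal (adj J z).
Proof.
move=> iJ; split.
- by exists 0, 0; split; [exact: ideal0 | ring].
- move=> _ _ [j [a [Jj ->]]] [j' [a' [Jj' ->]]].
  by exists (j + j'), (a + a'); split; [exact: idealD | ring].
move=> f _ [j [a [Jj ->]]].
by exists (f * j), (f * a); split; [exact: ideal_mull | ring].
Qed.

Lemma sub_adj J z : J `<=` adj J z.
Proof. by move=> j Jj; exists j, 0; split => //; ring. Qed.

Lemma mem_adj J z : is_ideal J -> adj J z z.
Proof. by move=> iJ; exists 0, 1; split; [exact: ideal0 | ring]. Qed.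

Lemma adj_sub I J z : is_ideal I -> J `<=` I -> I z -> adj J z `<=` I.
Proof.
move=> iI JI Iz _ [j [a [/JI Ij ->]]].
by apply: idealD => //; apply: ideal_mulr.
Qed.

Lemma adjC J y z : adj (adj J y) z = adj (adj J z) y.
Proof.
apply/seteqP; split=> _ [_ [a [[j [b [Jj ->]]] ->]]].
  by exists (j + z * a), b; split; [exists j, a | ring].
by exists (j + y * a), b; split; [exists j, a | ring].
Qed.

Definition colon J u : set R := [set t | J (t * u)].

Lemma colon_ideal J u : is_ideal J -> is_ideal (colon J u).
Proof.
move=> iJ; split; rewrite /colon /=.
- by rewrite mul0r; apply: ideal0.
- by move=> f g Jf Jg; rewrite mulrDl; apply: idealD.
by move=> f g Jg; rewrite -mulrA; apply: ideal_mull.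
Qed.

Definition nzd J z := forall p, J (z * p) -> J p.

(** Half of the interchange of two consecutive terms of a regular sequence.  If
    [y p = j + z q] with [j] in [J], then [z q] lies in [J + (y)], hence so does
    [q], and cancelling [y] shows that [p] is a multiple of [z] modulo [J]. *)
Lemma nzd_swap J y z : is_ideal J ->
  nzd J y -> nzd (adj J y) z -> nzd (adj J z) y.
Proof.
move=> iJ ny nz p [j [q [Jj e]]].
have [j' [q' [Jj' eq']]] : adj J y q.
  apply: nz; exists (- j), p; split; first exact: idealN.
  by rewrite e; ring.
have J1 : J (p - z * q').
  apply: ny; have -> : y * (p - z * q') = j + z * j'.
    by rewrite mulrBr e eq'; ring.
  by apply: idealD => //; apply: ideal_mull.
by exists (p - z * q'), q'; split => //; ring.
Qed.

End IdealTheory.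

(** * Noetherian rings and prime avoidance *)

Section Noetherian.
Variable R : comNzRingType.
Implicit Types (I J L : set R) (s : seq R).

Definition noetherian := forall I : nat -> set R,
  (forall k, is_ideal (I k)) -> (forall k, I k `<=` I k.+1) ->
  exists k, I k.+1 `<=` I k.

Hypothesis accR : noetherian.

(** Dependent choice turns a family without maximal member into a strictly
    ascending chain. *)
Lemma ideal_max (P : set (set R)) : (forall I, P I -> is_ideal I) ->
  (exists I, P I) ->
  exists2 I, P I & forall J, P J -> I `<=` J -> J `<=` I.
Proof.
move=> Pi [I0 PI0]; apply: contrapT => noI.
have next I : exists J, P I -> [/\ P J, I `<=` J & ~ J `<=` I].
  have [PI|nPI] := pselect (P I); last by exists I.
  apply: contrapT => nJ; apply: noI; exists I => // J PJ IJ.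
  by apply: contrapT => nJI; apply: nJ; exists J.
have [f fP] := choice next.
have Pf k : P (iter k f I0) by elim: k => // k /fP [].
have [k] := accR (fun k => Pi _ (Pf k)) (fun k => let: And3 _ h _ := fP _ (Pf k) in h).
by have [_ _] := fP _ (Pf k).
Qed.

Lemma ideal_ind (P : set R -> Prop) :
  (forall I, is_ideal I ->
     (forall J, is_ideal J -> I `<=` J -> ~ J `<=` I -> P J) -> P I) ->
  forall I, is_ideal I -> P I.
Proof.
move=> H I iI; apply: contrapT => nPI.
have [||J [iJ nPJ] mJ] := @ideal_max [set J | is_ideal J /\ ~ P J].
- by move=> J [].
- by exists I.
apply: nPJ; apply: H => // L iL JL nLJ; apply: contrapT => nPL.
by apply: nLJ; apply: mJ.
Qed.

Lemma fin_gen (A : set R) :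
  exists2 us : seq R, (forall u, u \in us -> A u) & A `<=` ideal_gen [set` us].
Proof.
pose P := [set I | exists2 us : seq R, (forall u, u \in us -> A u) &
                                       I = ideal_gen [set` us]].
have [||I [us usA ->] mI] := @ideal_max P.
- by move=> _ [us _ ->]; apply: is_ideal_gen.
- by exists (ideal_gen [set` [::]]), [::].
exists us => // a Aa; apply: (mI (ideal_gen [set` (a :: us)])).
- by exists (a :: us) => // u; rewrite inE => /predU1P[->|/usA].
- by apply: gen_mono => u /= uus; rewrite inE uus orbT.
by apply: mem_ideal_gen; rewrite /= mem_head.
Qed.

Definition is_prime P := is_ideal P /\
  forall a b : R, P (a * b) -> P a \/ P b.

(** The maximal ideals among the [(J : u)], [u] outside [J], are prime and cover
    the zerodivisors modulo [J].  They are finitely many for the following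
    reason: let [us] be finitely many such [u] that generate all of them.  If
    [(J : c)] is maximal and contains no [(J : u)] with [u] in [us], then a
    product of elements [t_u] of [(J : u)] outside [(J : c)] kills every [u],
    hence [c], although it lies outside the prime [(J : c)]. *)
Lemma ass_finite J : is_ideal J -> exists us : seq R,
  (forall u, u \in us -> ~ J u /\ is_prime (colon J u)) /\
  forall z, (forall u, u \in us -> ~ colon J u z) -> nzd J z.
Proof.
move=> iJ.
pose C := [set u | ~ J u /\ forall v, ~ J v -> colon J u `<=` colon J v ->
  colon J v `<=` colon J u].
have Cprime u : C u -> is_prime (colon J u).
  move=> [nJu mu]; split; first exact: colon_ideal.
  move=> a b Jab; have [Jb|nJb] := pselect (colon J u b); [by right|left].
  have := mu (b * u) nJb; apply.
    by move=> t; rewrite /colon /= mulrCA => Jtu; apply: ideal_mull.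
  by rewrite /colon /= mulrA.
have [us usC Cus] := fin_gen C.
exists us; split=> [u /usC Cu | z zus p Jzp].
  by split; [case: Cu | apply: Cprime].
apply: contrapT => nJp.
have [||_ [c [nJc pc] ->] mc] :=
  @ideal_max [set L | exists2 c, (~ J c /\ colon J p `<=` colon J c)
                                 & L = colon J c].
- by move=> _ [c _ ->]; apply: colon_ideal.
- by exists (colon J p) => /=; exists p; split.
have Cc : C c.
  split=> // v nJv cv; apply: mc => //; exists v => //; split=> //.
  exact: subset_trans cv.
have zc : colon J c z by apply: pc.
have nu u : u \in us -> exists t, colon J u t /\ ~ colon J c t.
  move=> uus; apply: contrapT => no; apply: (zus u uus).
  have [nJu mu] := usC u uus; apply: (mu c) => // t tu.
  by apply: contrapT => ntc; apply: no; exists t.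
have [t tJ ntc] : exists2 t, (forall u, u \in us -> colon J u t)
                           & ~ colon J c t.
  elim: us nu {usC Cus zus} => [|u us IH] nu.
    by exists 1 => //; rewrite /colon /= mul1r.
  have [|t tus ntc] := IH; first by move=> v vus; apply: nu; rewrite inE vus orbT.
  have [t' [t'u nt'c]] := nu u (mem_head _ _).
  exists (t * t'); last by move=> /(Cprime c Cc).2 [].
  move=> v; rewrite inE => /predU1P[->|/tus tv].
    by apply: ideal_mull t'u; apply: colon_ideal.
  by apply: ideal_mulr tv; apply: colon_ideal.
apply: ntc; rewrite /colon /= mulrC.
have iL : is_ideal [set x | J (x * t)] := colon_ideal t iJ.
apply: (gen_sub iL _ (Cus c Cc)) => u /= /tJ.
by rewrite /colon /= mulrC.
Qed.

(** Induction on the number of primes.  If [P] contains another member [Q] of the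
    list, avoiding [P] already avoids [Q], which can be dropped.  Otherwise some
    [t * w] in [m] lies in all the other primes but not in [P], and adding it to
    an element that avoids the others moves that element out of [P]. *)
Lemma prime_avoidance (m : set R) (Ps : seq (set R)) : is_ideal m ->
  (forall P, P \in Ps -> is_prime P /\ ~ m `<=` P) ->
  exists2 z, m z & forall P, P \in Ps -> ~ P z.
Proof.
move=> im; have [k] := ubnP (size Ps); elim: k Ps => // k IH [|P Ps] /=.
  by exists 0; [exact: ideal0 |].
rewrite ltnS => sPs PsP.
have [pP nmP] := PsP P (mem_head _ _).
have [[Q QPs QP]|noQ] := pselect (exists2 Q, Q \in Ps & Q `<=` P).
  have [||z mz zP] := IH (P :: rem Q Ps).
  - by rewrite /= size_rem // prednK //; case: (Ps) QPs.
  - move=> P'; rewrite inE => /predU1P[->|/mem_rem P'Ps]; first exact: PsP (mem_head _ _).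
    by apply: PsP; rewrite inE P'Ps orbT.
  exists z => // P'; rewrite inE => /predU1P[->|P'Ps]; first exact: zP (mem_head _ _).
  have [->|nP'Q] := eqVneq P' Q; first by move=> /QP; apply: zP (mem_head _ _).
  by apply: zP; rewrite inE rem_mem ?orbT.
have [||z mz zPs] := IH Ps.
- exact: sPs.
- by move=> P' P'Ps; apply: PsP; rewrite inE P'Ps orbT.
have [Pz|nPz] := pselect (P z); last first.
  by exists z => // P'; rewrite inE => /predU1P[->|/zPs].
have [t mt nPt] : exists2 t, m t & ~ P t.
  by apply: contrapT => no; apply: nmP => t mt; apply: contrapT => ?; apply: no; exists t.
have [w wPs nPw] : exists2 w, (forall Q, Q \in Ps -> Q w) & ~ P w.
  have {IH zPs sPs} : forall Q, Q \in Ps -> is_ideal Q.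
    by move=> Q QPs; have [|[]] := PsP Q; rewrite // inE QPs orbT.
  elim: Ps noQ {PsP} => [|Q Ps IH] noQ iQ.
    by exists 1 => // P1; apply: nPt; rewrite -[t]mulr1; apply: ideal_mull P1; case: pP.
  have [||w wPs nPw] := IH.
  - by move=> [Q' Q'Ps ?]; apply: noQ; exists Q' => //; rewrite inE Q'Ps orbT.
  - by move=> Q' Q'Ps; apply: iQ; rewrite inE Q'Ps orbT.
  have [q Qq nPq] : exists2 q, Q q & ~ P q.
    apply: contrapT => no; apply: noQ; exists Q; first exact: mem_head.
    by move=> q Qq; apply: contrapT => ?; apply: no; exists q.
  exists (q * w); last by move=> /(pP.2) [].
  move=> Q'; rewrite inE => Q'Ps; have iQ' := iQ Q'; case/predU1P: Q'Ps => [e|Q'Ps].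
    by rewrite e; apply: ideal_mulr => //; rewrite -e; apply: iQ'; rewrite e mem_head.
  by apply: ideal_mull; [apply: iQ'; rewrite inE Q'Ps orbT | apply: wPs].
have iP := pP.1.
exists (z + t * w); first by apply: idealD => //; apply: ideal_mulr.
move=> Q; rewrite inE => /predU1P[->|QPs] Qz.
  by have /pP.2[] : P (t * w) by apply: idealDl Qz.
apply: (zPs Q QPs).
have iQ : is_ideal Q by have [|[]] := PsP Q; rewrite // inE QPs orbT.
have -> : z = (z + t * w) - t * w by ring.
by apply: idealB => //; apply: ideal_mull => //; apply: wPs.
Qed.

End Noetherian.
(** * Depth by regular sequences *)

Section Depth.
Variables (R : comNzRingType) (m : set R).
Implicit Types (I J L : set R) (s : seq R).
Hypothesis accR : noetherian R.
Hypothesis im : is_ideal m.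

Definition socle J := exists2 u, ~ J u & forall t, m t -> J (t * u).

Lemma socle_nzd J z : socle J -> m z -> ~ nzd J z.
Proof. by move=> [u nJu Ju] mz nz; apply: nJu; apply: nz; apply: Ju. Qed.

(** If every element of [m] were a zerodivisor modulo one of the [J], prime
    avoidance would put [m] inside some associated prime [(J : u)], and [u]
    would be a socle element. *)
Lemma common_nzd (Js : seq (set R)) :
  (forall J, J \in Js -> is_ideal J /\ ~ socle J) ->
  exists2 z, m z & forall J, J \in Js -> nzd J z.
Proof.
move=> JsP.
have [Ps [PsP Psnz]] : exists Ps : seq (set R),
    (forall P, P \in Ps -> is_prime P /\ ~ m `<=` P) /\
    (forall z, (forall P, P \in Ps -> ~ P z) -> forall J, J \in Js -> nzd J z).
  elim: Js JsP => [|J Js IH] JsP; first by exists [::]; split.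
  have [|Ps [PsP Psnz]] := IH; first by move=> L LJs; apply: JsP; rewrite inE LJs orbT.
  have [iJ nsJ] := JsP J (mem_head _ _).
  have [us [usP usnz]] := ass_finite accR iJ.
  exists ([seq colon J u | u <- us] ++ Ps); split.
    move=> P; rewrite mem_cat => /orP[/mapP[u uus ->]|/PsP //].
    have [nJu pu] := usP u uus; split=> // mu.
    by apply: nsJ; exists u => // t /mu.
  move=> z zP L; rewrite inE => /predU1P[->|].
    by apply: usnz => u uus; apply: zP; rewrite mem_cat map_f.
  by apply: Psnz => P PPs; apply: zP; rewrite mem_cat PPs orbT.
have [z mz zPs] := prime_avoidance im PsP.
by exists z => // J; apply: Psnz.
Qed.

(** If [u] is a socle element modulo [J + (y)], then [z u = y v] modulo [J] for
    some [v], which is a socle element modulo [J + (z)]: the relation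
    [y (t v) = z (t u)] has its right side in [z y R + J], and [y] cancels. *)
Lemma socle_swap J y z : is_ideal J -> m z ->
  nzd J y -> nzd J z -> socle (adj J y) -> socle (adj J z).
Proof.
move=> iJ mz ny nz [u nu mu].
have [j [v [Jj e]]] := mu z mz.
exists v.
  move=> [j' [w [Jj' ev]]]; apply: nu; rewrite -[u](subrK (y * w)) addrC.
  exists (u - y * w), w; split; last by ring.
  apply: nz; have -> : z * (u - y * w) = j + y * j' by rewrite mulrBr e ev; ring.
  by apply: idealD => //; apply: ideal_mull.
move=> t mt; have [j' [w [Jj' et]]] := mu t mt.
exists (t * v - z * w), w; split; last by ring.
apply: ny; have -> : y * (t * v - z * w) = z * j' - t * j.
  have -> : j = z * u - y * v by rewrite e; ring.
  by have -> : j' = t * u - y * w by [rewrite et; ring]; ring.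
by apply: idealB => //; apply: ideal_mull.
Qed.

(** The depth of [R/J] in the form of a maximal regular sequence of length [r]
    given one term at a time; that [r] depends on [J] only is
    [depth_is_inj]. *)
Fixpoint depth_is (r : nat) J : Prop :=
  if r is r'.+1 then exists z, [/\ m z, nzd J z & depth_is r' (adj J z)]
  else socle J.

Lemma depth_isS_nsocle r J : depth_is r.+1 J -> ~ socle J.
Proof. by move=> [z [mz nz _]] /socle_nzd /(_ mz). Qed.

(** The choice of the nonzerodivisor does not matter.  For [r = 0] this is
    [socle_swap].  In general the given sequence starts with some [y]; pick [w]
    that is a nonzerodivisor modulo [J], [J + (y)] and [J + (z)].  Replacing
    [y] by [w] and then [w] by [z] uses the statement for shorter sequences,
    over [J + (y)] and over [J + (w)]. *)
Lemma depth_is_adj r J z : is_ideal J -> m z -> nzd J z ->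
  depth_is r.+1 J -> depth_is r (adj J z).
Proof.
elim: r J z => [|r IH] J z iJ mz nz [y [my ny dy]].
  exact: socle_swap dy.
have nsy := depth_isS_nsocle dy.
have nsz : ~ socle (adj J z) by move=> sz; apply: nsy; apply: socle_swap sz.
have [|w mw nw] := @common_nzd [:: J; adj J y; adj J z].
  move=> L; rewrite !inE => /or3P[] /eqP ->; split=> //; try exact: adj_ideal.
  by move=> /socle_nzd /(_ mz).
have nwJ : nzd J w by apply: nw; rewrite !inE eqxx.
have nwy : nzd (adj J y) w by apply: nw; rewrite !inE eqxx orbT.
have nwz : nzd (adj J z) w by apply: nw; rewrite !inE eqxx !orbT.
exists w; split => //; rewrite adjC; apply: (IH) => //; first exact: adj_ideal.
  exact: nzd_swap nwz.
exists y; split => //; first exact: nzd_swap nwy.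
by rewrite adjC; apply: IH => //; apply: adj_ideal.
Qed.

Lemma depth_is_inj r q J : is_ideal J -> depth_is r J -> depth_is q J -> r = q.
Proof.
elim: r q J => [|r IH] [|q] J iJ //.
- by move=> sJ /depth_isS_nsocle.
- by move=> /depth_isS_nsocle.
move=> [z [mz nz dz]] dJ; congr S; apply: IH dz _; first exact: adj_ideal.
exact: depth_is_adj dJ.
Qed.

(** Adjoining a nonzerodivisor to a proper ideal enlarges it, so the search for a
    regular sequence stops. *)
Lemma depth_is_ex J : ~ m 1 -> is_ideal J -> J `<=` m -> exists r, depth_is r J.
Proof.
move=> nm1; move: J; apply: (ideal_ind accR) => J iJ IH Jm.
have [sJ|nsJ] := pselect (socle J); first by exists 0%N.
have [|z mz nz] := @common_nzd [:: J].
  by move=> L; rewrite mem_seq1 => /eqP ->.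
have nJz : nzd J z by apply: nz; rewrite mem_seq1.
have [||r dr] := IH (adj J z) (adj_ideal z iJ) (@sub_adj _ _ _).
- move=> /(_ _ (mem_adj z iJ)) Jz; apply: nm1; apply: Jm; apply: nJz.
  by rewrite mulr1.
- exact: adj_sub.
by exists r.+1, z.
Qed.

Definition ideal_add I J : set R := [set p | exists i j, [/\ I i, J j & p = i + j]].

Lemma ideal_add_ideal I J : is_ideal I -> is_ideal J -> is_ideal (ideal_add I J).
Proof.
move=> iI iJ; split.
- by exists 0, 0; split; [exact: ideal0..|ring].
- move=> _ _ [i [j [Ii Jj ->]]] [i' [j' [Ii' Jj' ->]]].
  by exists (i + i'), (j + j'); split; [exact: idealD..|ring].
move=> f _ [i [j [Ii Jj ->]]].
by exists (f * i), (f * j); split; [exact: ideal_mull..|ring].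
Qed.

Lemma adj_ideal_add I J z : is_ideal J ->
  ideal_add (adj I z) (adj J z) = adj (ideal_add I J) z.
Proof.
move=> iJ; apply/seteqP; split=> p.
  move=> [_ [_ [[i [a [Ii ->]]] [j [b [Jj ->]]] ->]]].
  by exists (i + j), (a + b); split; [exists i, j | ring].
move=> [_ [a [[i [j [Ii Jj ->]]] ->]]].
exists (i + z * a), j; split; [by exists i, a | exact: sub_adj | ring].
Qed.

(** Exactness of [0 -> R/(I cap J) -> R/I (+) R/J -> R/(I + J) -> 0] is preserved
    modulo an element that is a nonzerodivisor on the last term. *)
Lemma adj_setI I J z : is_ideal I -> is_ideal J -> nzd (ideal_add I J) z ->
  adj I z `&` adj J z = adj (I `&` J) z.
Proof.
move=> iI iJ nz; apply/seteqP; split=> p; last first.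
  by move=> [i [a [[Ii Ji] ->]]]; split; exists i, a.
move=> [[i [a [Ii ->]]] [j [b [Jj e]]]].
have [i' [j' [Ii' Jj' eab]]] : ideal_add I J (a - b).
  apply: nz; exists (- i), j; split => //; first exact: idealN.
  have -> : z * (a - b) = (i + z * a) - i - z * b by ring.
  by rewrite e; ring.
exists (i + z * i'), (a - i'); split; last by ring.
split; first by apply: idealD => //; apply: ideal_mull.
have -> : i + z * i' = j - z * j'.
  have -> : i = j + z * b - z * a by rewrite -e; ring.
  have -> : i' = a - b - j' by rewrite eab; ring.
  ring.
by apply: idealB => //; apply: ideal_mull.
Qed.

(** The depth lemma for [0 -> R/(I cap J) -> R/I (+) R/J -> R/(I + J) -> 0] when
    the last term has the smallest depth [r].  A common nonzerodivisor reduces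
    [r] by one.  For [r = 0] let [u] be a socle element modulo [I + J] and [z]
    in [m] a nonzerodivisor modulo [I] and [J]; write [z u = i + j].  Then [i]
    is a socle element modulo [(I cap J) + (z)], which is the connecting
    homomorphism of the snake lemma applied to [u]. *)
Lemma depth_setI r a b I J : is_ideal I -> is_ideal J ->
  depth_is r (ideal_add I J) -> depth_is a I -> depth_is b J ->
  (r < a)%N -> (r < b)%N -> depth_is r.+1 (I `&` J).
Proof.
elim: r a b I J => [|r IH] [|a] [|b] I J iI iJ // dIJ dI dJ.
  move=> _ _; have [|z mz nz] := @common_nzd [:: I; J].
    by move=> L; rewrite !inE => /orP[] /eqP ->; split=> //;
      [apply: depth_isS_nsocle dI | apply: depth_isS_nsocle dJ].
  have nI : nzd I z by apply: nz; rewrite !inE eqxx.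
  have nJ : nzd J z by apply: nz; rewrite !inE eqxx orbT.
  exists z; split => //; first by move=> p [/nI ? /nJ ?].
  have [u nu mu] := dIJ; have [i [j [Ii Jj e]]] := mu z mz.
  exists i.
    move=> [w [v [[Iw Jw] ei]]]; apply: nu; exists v, (u - v); split.
    - apply: nI; have -> : z * v = i - w by rewrite ei; ring.
      exact: idealB.
    - apply: nJ; have -> : z * (u - v) = j + w.
        by rewrite mulrBr e ei; ring.
      exact: idealD.
    - ring.
  move=> t mt; have [i' [j' [Ii' Jj' e']]] := mu t mt.
  exists (t * i - z * i'), i'; split; last by ring.
  split; first by apply: idealB => //; apply: ideal_mull.
  have -> : t * i - z * i' = z * j' - t * j.
    have -> : i = z * u - j by rewrite e; ring.
    by have -> : i' = t * u - j' by [rewrite e'; ring]; ring.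
  by apply: idealB => //; apply: ideal_mull.
rewrite !ltnS => ra rb.
have [|z mz nz] := @common_nzd [:: I; J; ideal_add I J].
  move=> L; rewrite !inE => /or3P[] /eqP ->; split=> //.
  - exact: depth_isS_nsocle dI.
  - exact: depth_isS_nsocle dJ.
  - exact: ideal_add_ideal.
  - exact: depth_isS_nsocle dIJ.
have nI : nzd I z by apply: nz; rewrite !inE eqxx.
have nJ : nzd J z by apply: nz; rewrite !inE eqxx orbT.
have nIJ : nzd (ideal_add I J) z by apply: nz; rewrite !inE eqxx !orbT.
exists z; split => //; first by move=> p [/nI ? /nJ ?].
rewrite -adj_setI //; apply: (IH a b) => //; try exact: adj_ideal.
- by rewrite adj_ideal_add //; apply: depth_is_adj dIJ => //; apply: ideal_add_ideal.
- exact: depth_is_adj dI.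
- exact: depth_is_adj dJ.
Qed.

Lemma gen_adj J z s : is_ideal J ->
  ideal_gen (adj J z `|` [set` s]) = ideal_gen (J `|` [set` z :: s]).
Proof.
move=> iJ; apply/seteqP; split.
  apply: gen_sub; first exact: is_ideal_gen.
  move=> p [|/= ps]; last by apply: mem_ideal_gen; right; rewrite /= inE ps orbT.
  apply: adj_sub; first exact: is_ideal_gen.
    by move=> j Jj; apply: mem_ideal_gen; left.
  by apply: mem_ideal_gen; right; rewrite /= mem_head.
apply: gen_mono => p [Jp|/=]; first by left; apply: sub_adj.
rewrite inE => /predU1P[->|ps]; [by left; apply: mem_adj | by right].
Qed.

Lemma gen_nil J : is_ideal J -> ideal_gen (J `|` [set` [::]]) = J.
Proof. by move=> iJ; rewrite set_nil setU0 gen_id. Qed.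

Lemma regular_nil J : is_ideal J -> regular_seq J [::] <-> ~ J 1.
Proof.
move=> iJ; split=> [[_]|n1]; first by rewrite gen_nil.
by split=> [i|]; [rewrite ltn0 | rewrite gen_nil].
Qed.

Lemma regular_cons J z s : is_ideal J ->
  regular_seq J (z :: s) <-> nzd J z /\ regular_seq (adj J z) s.
Proof.
move=> iJ; rewrite /regular_seq gen_adj //; split.
  move=> [reg n1]; split.
    by move=> p; have := reg 0%N isT p; rewrite /= gen_nil.
  split=> // i isz f; have := reg i.+1 isz f => /=.
  by rewrite gen_adj.
move=> [nz [reg n1]]; split=> // -[_ f|i isz f] /=.
  by rewrite gen_nil //; apply: nz.
by have := reg i isz f; rewrite gen_adj.
Qed.

Lemma regular_le_depth r J s : is_ideal J -> depth_is r J ->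
  (forall z, z \in s -> m z) -> regular_seq J s -> (size s <= r)%N.
Proof.
elim: s r J => [|z s IH] // r J iJ dJ ms /regular_cons [] // nz rs.
have mz : m z by apply: ms; rewrite mem_head.
case: r dJ => [sJ|r dJ]; first by case: (socle_nzd sJ mz).
rewrite /= ltnS; apply: (IH r (adj J z)) => //; first exact: adj_ideal.
  exact: depth_is_adj dJ.
by move=> y ys; apply: ms; rewrite inE ys orbT.
Qed.

Lemma depth_regular r J : ~ m 1 -> is_ideal J -> J `<=` m -> depth_is r J ->
  exists s, [/\ size s = r, forall z, z \in s -> m z & regular_seq J s].
Proof.
move=> nm1; elim: r J => [|r IH] J iJ Jm.
  move=> _; exists [::]; split=> //; apply/regular_nil => //.
  by move=> /Jm.
move=> [z [mz nz /IH []]]; [exact: adj_ideal | exact: adj_sub|].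
move=> s [ss ms rs]; exists (z :: s); split; first by rewrite /= ss.
  by move=> y; rewrite inE => /predU1P[->|/ms].
by apply/regular_cons.
Qed.

End Depth.

Lemma nat_maxE (A : set nat) d : A d -> (forall e, A e -> (e <= d)%N) ->
  nat_max A = d.
Proof.
move=> Ad dP; rewrite /nat_max; apply: xget_unique; first by split.
by move=> e [Ae eP]; apply/eqP; rewrite eqn_leq dP //= eP.
Qed.

Lemma nat_minE (A : set nat) d : A d -> (forall e, A e -> (d <= e)%N) ->
  nat_min A = d.
Proof.
move=> Ad dP; rewrite /nat_min; apply: xget_unique; first by split.
by move=> e [Ae eP]; apply/eqP; rewrite eqn_leq dP // andbT eP.
Qed.
(** * Polynomial rings over a field are Noetherian *)

Section MpolyNoetherian.

(** Each next index is chosen to minimize the value on the remaining tail. *)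
Lemma nat_seq_monotone (f : nat -> nat) : exists2 g : nat -> nat,
  (forall k, (g k < g k.+1)%N) & (forall k, (f (g k) <= f (g k.+1))%N).
Proof.
have next k : exists i, (k < i)%N /\ forall j, (k < j)%N -> (f i <= f j)%N.
  suff min v i : (k < i)%N -> (f i < v)%N ->
      exists i, (k < i)%N /\ forall j, (k < j)%N -> (f i <= f j)%N.
    exact: (min _ _ (ltnSn k) (ltnSn (f k.+1))).
  elim: v i => // v IH i ki; rewrite ltnS => fi.
  have [[j kj fj]|no] := pselect (exists2 j, (k < j)%N & (f j < f i)%N).
    by apply: (IH j) => //; apply: leq_trans fj fi.
  exists i; split=> // j kj; rewrite leqNgt; apply/negP => fj.
  by apply: no; exists j.
have [h hP] := choice next.
exists (fun k => iter k.+1 h 0%N) => k /=.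
  by have [] := hP (h (iter k h 0%N)).
have [lt1 le1] := hP (iter k h 0%N).
by apply: le1; apply: (leq_trans lt1); have [/ltnW] := hP (h (iter k h 0%N)).
Qed.

(** Successive subsequences make one coordinate after the other nondecreasing. *)
Lemma dickson n (u : nat -> 'X_{1..n}) :
  exists i j, (i < j)%N /\ (u i <= u j)%MM.
Proof.
have [g gP ug] : exists2 g : nat -> nat, (forall k, (g k < g k.+1)%N) &
    forall c, c \in enum 'I_n -> forall k, (u (g k) c <= u (g k.+1) c)%N.
  elim: (enum 'I_n) => [|c cs [g gP ug]]; first by exists id.
  have [h hP uh] := nat_seq_monotone (fun k => u (g k) c).
  have gmono i j : (i < j)%N -> (g i < g j)%N.
    elim: j => // j IH; rewrite ltnS leq_eqVlt => /predU1P[->|/IH] //.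
    by move=> lt; apply: ltn_trans lt _.
  exists (g \o h) => [k|d]; first exact: gmono.
  rewrite inE => /predU1P[->|dcs] k //=.
  have : (h k < h k.+1)%N by [].
  elim: (h k.+1) => // j IH; rewrite ltnS leq_eqVlt => /predU1P[->|/IH le1].
    exact: ug.
  by apply: leq_trans le1 _; apply: ug.
exists (g 0%N), (g 1%N); split=> //; apply/mnm_lepP => c.
by apply: ug; rewrite mem_enum.
Qed.

(** In a strictly ascending chain take [p k] in [I k.+1] outside [I k] with the
    smallest possible leading monomial.  By [dickson] the leading monomial of
    some [p i] divides that of a later [p j]; cancelling it gives an element of
    [I j.+1] outside [I j] with a smaller leading monomial. *)
Lemma mpoly_noetherian (K : fieldType) n : noetherian {mpoly K[n]}.
Proof.
move=> I iI mI; apply: contrapT => noI.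
have IS k : exists p, [/\ I k.+1 p, ~ I k p &
    forall q, I k.+1 q -> ~ I k q -> (mlead p <= mlead q)%O].
  have [p Ip nIp] : exists2 p, I k.+1 p & ~ I k p.
    apply: contrapT => no; apply: noI; exists k => p Ip.
    by apply: contrapT => nIp; apply: no; exists p.
  have [v ev] : exists v, v = mlead p by exists (mlead p).
  elim: (ltom_wf v) p Ip nIp ev => {}v _ IH p Ip nIp ev.
  have [[q [Iq nIq lt]]|no] :=
      pselect (exists q, [/\ I k.+1 q, ~ I k q & (mlead q < mlead p)%O]).
    by apply: (IH (mlead q)) Iq nIq _ => //; rewrite ev.
  exists p; split=> // q Iq nIq; rewrite leNgt; apply/negP => lt.
  by apply: no; exists q.
have [p pP] := choice IS.
have [i [j [ij le_ij]]] := dickson (fun k => mlead (p k)).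
have [Ii nIi _] := pP i; have [Ij nIj minj] := pP j.
have subI a b : (a <= b)%N -> I a `<=` I b.
  elim: b => [|b IH]; first by rewrite leqn0 => /eqP ->.
  by rewrite leq_eqVlt => /predU1P[->//|/IH Iab]; apply: subset_trans Iab (mI b).
have nz k : p k != 0.
  by apply/eqP => pk0; have [_ + _] := pP k; rewrite pk0; apply; apply: ideal0.
pose c := mleadc (p j) / mleadc (p i).
pose q := c *: 'X_[mlead (p j) - mlead (p i)] * p i.
have c0 : c != 0 by rewrite mulf_neq0 ?invr_eq0 ?mleadc_eq0.
have qE : mlead q = mlead (p j).
  rewrite /q -scalerAl mleadZ // mleadM ?mleadXm ?submK //.
  by rewrite -msize_poly_eq0 msizeX.
have qcE : mleadc q = mleadc (p j).
  have := mleadcM 'X_[K, mlead (p j) - mlead (p i)] (p i).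
  rewrite mleadXm submK // mcoeffX eqxx mul1r => e.
  by rewrite qE /q -scalerAl mcoeffZ e /c divfK // mleadc_eq0.
have Iq : I j q by apply: ideal_mull => //; apply: subI Ii.
have nIpq : ~ I j (p j - q).
  by move=> Ipq; apply: nIj; rewrite -[p j](subrK q); apply: idealD.
have Ipq : I j.+1 (p j - q) by apply: idealB => //; apply: mI.
have := minj _ Ipq nIpq.
have pq0 : p j - q != 0 by apply/eqP => e; apply: nIpq; rewrite e; apply: ideal0.
have le1 : (mlead (p j - q) <= mlead (p j))%O.
  by apply: le_trans (mleadB_le _ _) _; rewrite qE joinxx.
move=> le2; have e : mlead (p j - q) = mlead (p j).
  by apply: le_anti; rewrite le1.
have := mleadc_eq0 (p j - q); rewrite (negbTE pq0) e mcoeffB -{2}qE qcE subrr.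
by rewrite eqxx.
Qed.

End MpolyNoetherian.
(** * A complement of an ideal in the polynomial ring *)

Section LinearExtension.
Variables (K : fieldType) (n : nat) (V : lmodType K) (h : 'X_{1..n} -> V).

Definition mlin (p : {mpoly K[n]}) : V := \sum_(u <- msupp p) p@_u *: h u.

Lemma mlinwE k p : (msize p <= k)%N ->
  mlin p = \sum_(u : 'X_{1..n < k}) p@_u *: h u.
Proof.
move=> le_pk; pose I : subFinType _ := 'X_{1..n < k}.
rewrite /mlin (big_mksub I) /=; first last.
- by move=> u /msize_mdeg_lt /leq_trans; apply.
- by rewrite msupp_uniq.
by rewrite big_rmcond //= => u /memN_msupp_eq0 ->; rewrite scale0r.
Qed.

Lemma mlin_is_linear : linear mlin.
Proof.
move=> c p q; pose k := maxn (msize (c *: p + q)) (maxn (msize p) (msize q)).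
rewrite !(@mlinwE k) ?leq_max ?leqnn ?orbT //.
rewrite scaler_sumr -big_split /=; apply: eq_bigr => u _.
by rewrite mcoeffD mcoeffZ scalerDl scalerA.
Qed.

HB.instance Definition _ :=
  GRing.isLinear.Build K {mpoly K[n]} V _ mlin mlin_is_linear.

Lemma mlinX u : mlin 'X_[u] = h u.
Proof. by rewrite /mlin msuppX big_seq1 mcoeffX eqxx scale1r. Qed.

End LinearExtension.

Section NormalForm.
Variables (K : fieldType) (n : nat) (L : set {mpoly K[n]}).
Hypothesis iL : is_ideal L.
Implicit Types p q : {mpoly K[n]}.

Lemma idealZ c p : L p -> L (c *: p).
Proof. by rewrite -mul_mpolyC; apply: ideal_mull. Qed.

(** The monomials that lead no element of [L]; their classes form a basis of the
    quotient by [L]. *)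
Definition standard (u : 'X_{1..n}) :=
  forall p, L p -> p != 0 -> mlead p != u.

Definition reduced p := forall u, u \in msupp p -> standard u.

Lemma reduced_lin c p q : reduced p -> reduced q -> reduced (c *: p + q).
Proof.
move=> rp rq u /msuppD_le; rewrite mem_cat => /orP[/msuppZ_le|] ?.
  exact: rp.
exact: rq.
Qed.

Lemma reduced_eq0 p : reduced p -> L p -> p = 0.
Proof.
move=> rp Lp; apply/eqP/negPn/negP => p0.
by have := rp _ (mlead_supp p0) p Lp p0; rewrite eqxx.
Qed.

(** Division algorithm: the leading term of [p] is moved to the remainder if it is
    standard and otherwise cancelled by an element of [L]; the monomial order is
    well founded. *)
Lemma reduced_ex p : exists q, reduced q /\ L (p - q).
Proof.
have [v lev] : exists v, (forall u, u \in msupp p -> (u <= v)%O).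
  by exists (mlead p) => u; apply: msupp_le_mlead.
elim: (ltom_wf v) p lev => {}v _ IH p lev.
have step r : (forall u, u \in msupp r -> (u <= v)%O) -> r@_v = 0 ->
    exists q, reduced q /\ L (r - q).
  move=> ler rv0; have [->|r0] := eqVneq r 0.
    exists 0; split; first by move=> u; rewrite msupp0.
    by rewrite subr0; apply: ideal0.
  apply: (IH (mlead r)); last by move=> u; apply: msupp_le_mlead.
  rewrite lt_neqAle ler ?mlead_supp // andbT.
  by apply: contra_eq_neq rv0 => <-; rewrite mleadc_eq0.
have [sv|nsv] := pselect (standard v).
  have [||q [rq Lq]] := step (p - p@_v *: 'X_[v]).
  - move=> u /msuppB_le; rewrite mem_cat => /orP[/lev //|/msuppZ_le].
    by rewrite msuppX inE => /eqP ->.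
  - by rewrite mcoeffB mcoeffZ mcoeffX eqxx mulr1 subrr.
  exists (p@_v *: 'X_[v] + q); split; last by rewrite opprD addrA.
  by apply: reduced_lin => // u; rewrite msuppX inE => /eqP ->.
have [l [Ll l0 lv]] : exists l, [/\ L l, l != 0 & mlead l = v].
  apply: contrapT => no; apply: nsv => l Ll l0; apply/eqP => lv.
  by apply: no; exists l.
have [||q [rq Lq]] := step (p - (p@_v / mleadc l) *: l).
- move=> u /msuppB_le; rewrite mem_cat => /orP[/lev //|/msuppZ_le].
  by move=> /msupp_le_mlead; rewrite lv.
- by rewrite mcoeffB mcoeffZ -lv divfK ?subrr // mleadc_eq0.
exists q; split => //; set c := _ / _ in Lq.
have -> : p - q = (p - c *: l - q) + c *: l by ring.
by apply: idealD => //; apply: idealZ.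
Qed.

(** Reduced forms are unique, since a reduced element of [L] vanishes; hence the
    choice of remainders is linear. *)
Lemma normal_form : exists N : {linear {mpoly K[n]} -> {mpoly K[n]}},
  (forall p, L (p - N p)) /\ (forall p, L p -> N p = 0).
Proof.
have [N NP] := choice reduced_ex.
have linN : linear N.
  move=> c p q; apply/eqP; rewrite -subr_eq0; apply/eqP.
  have [[rp Lp] [rq Lq]] := (NP p, NP q); have [r Lr] := NP (c *: p + q).
  apply: reduced_eq0.
    have -> : N (c *: p + q) - (c *: N p + N q) =
      (- c) *: N p + ((-1) *: N q + N (c *: p + q)).
      by rewrite scaleN1r scaleNr; ring.
    by apply: reduced_lin => //; apply: reduced_lin.
  have -> : N (c *: p + q) - (c *: N p + N q) =
    c *: (p - N p) + (q - N q) - (c *: p + q - N (c *: p + q)).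
    by rewrite scalerBr; ring.
  by apply: idealB => //; apply: idealD => //; apply: idealZ.
pose NL : {linear {mpoly K[n]} -> {mpoly K[n]}} :=
  HB.pack N (GRing.isLinear.Build _ _ _ _ N linN).
exists NL; split=> p; first by case: (NP p).
move=> Lp; apply: reduced_eq0; first by case: (NP p).
have -> : NL p = p - (p - N p) by rewrite subKr.
by apply: idealB => //; case: (NP p).
Qed.

End NormalForm.
(** * Ideals in a tensor product of two polynomial rings *)

Section Tensor.
Variables (K : fieldType) (n m : nat) (S : comNzRingType).
Variables (alpha : {rmorphism {mpoly K[n]} -> S}).
Variables (beta : {rmorphism {mpoly K[m]} -> S}).
Implicit Types (J : set {mpoly K[n]}) (L : set {mpoly K[m]}).

Definition ext J L : set S := ideal_gen (alpha @` J `|` beta @` L).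

(** [spanned] and [contractible] are what the proofs below use of the fact that
    [S] is the tensor product over [K]: it is spanned by products, and a linear
    form on the second factor induces an additive map to the first one, which
    says that linearly independent elements of the second factor stay
    independent over the first. *)
Definition spanned := forall p : S,
  exists s : seq ({mpoly K[n]} * {mpoly K[m]}),
    p = \sum_(x <- s) alpha x.1 * beta x.2.

Definition contractible := forall phi : {scalar {mpoly K[m]}},
  exists Phi : {additive S -> {mpoly K[n]}},
    forall a b, Phi (alpha a * beta b) = phi b *: a.

Hypothesis spanS : spanned.
Hypothesis scalS : forall c, alpha c%:MP = beta c%:MP.
Hypothesis contractS : contractible.

Lemma ext_ideal J L : is_ideal (ext J L).
Proof. exact: is_ideal_gen. Qed.

Lemma ext_l J L a : J a -> ext J L (alpha a).
Proof. by move=> Ja; apply: mem_ideal_gen; left; exists a. Qed.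

Lemma ext_r J L b : L b -> ext J L (beta b).
Proof. by move=> Lb; apply: mem_ideal_gen; right; exists b. Qed.

Lemma ext_adj J L a : is_ideal J ->
  ext (adj J a) L = adj (ext J L) (alpha a).
Proof.
move=> iJ; have iE := adj_ideal (alpha a) (ext_ideal J L).
apply/seteqP; split.
  apply: gen_sub => // _ [[_ [j [c [Jj ->]]] <-]|[b Lb <-]].
    rewrite rmorphD rmorphM; exists (alpha j), (alpha c).
    by split=> //; apply: ext_l.
  by apply: sub_adj; apply: ext_r.
apply: adj_sub; first exact: ext_ideal.
  apply: gen_mono => _ [[j Jj <-]|[b Lb <-]]; last by right; exists b.
  by left; exists j => //; apply: sub_adj.
by apply: ext_l; apply: mem_adj.
Qed.

(** The coordinates [Phi u] of [p] along the standard monomials [u] of [L]: [S]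
    modulo the extension of [L] is free over the first factor on them, so
    membership in the extension of [J] and [L] is tested on coordinates.  The
    contraction is taken along the linear form that reads off the coefficient of
    [u] in the normal form. *)
Lemma ext_coords L : is_ideal L -> exists Phi : 'X_{1..m} -> S -> {mpoly K[n]},
  [/\ forall u f p, Phi u (alpha f * p) = f * Phi u p,
      forall J p, is_ideal J -> ext J L p <-> forall u, J (Phi u p) &
      forall b, ~ L b -> exists u c, c != 0 /\
        forall a, Phi u (alpha a * beta b) = c *: a].
Proof.
move=> iL; have [N [NL LN]] := normal_form iL.
have [Phi PhiE] := choice (fun u => contractS (mcoeff u \o N)).
have PhiM u f p : Phi u (alpha f * p) = f * Phi u p.
  have [s ->] := spanS p; rewrite mulr_sumr !raddf_sum mulr_sumr.
  apply: eq_bigr => x _; rewrite mulrA -rmorphM !PhiE.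
  by rewrite -scalerAr.
exists (fun u p => Phi u p); split=> //; last first.
  move=> b nLb; have : N b != 0.
    by apply/eqP => Nb; apply: nLb; rewrite -[b]subr0 -Nb.
  move=> Nb; exists (mlead (N b)), (mleadc (N b)); rewrite mleadc_eq0.
  by split=> // a; rewrite PhiE.
move=> J p iJ; split.
  (* The factor [q] is there because [Phi u] is not linear over the second
     factor. *)
  have iW : is_ideal [set p | forall q u, J (Phi u (q * p))].
    split=> /=.
    - by move=> q u; rewrite mulr0 raddf0; apply: ideal0.
    - by move=> f g Wf Wg q u; rewrite mulrDr raddfD; apply: idealD.
    - by move=> f g Wg q u; rewrite mulrA.
  suff EW : ext J L `<=` [set p | forall q u, J (Phi u (q * p))].
    by move=> /EW W u; rewrite -[p]mul1r; apply: W.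
  apply: gen_sub iW _ => _ [[j Jj <-]|[l Ll <-]] /= q u.
    rewrite (mulrC q) PhiM. exact: ideal_mulr.
  have [s ->] := spanS q; rewrite mulr_suml raddf_sum; apply: ideal_sum => // x _.
  rewrite -mulrA -rmorphM PhiE /= LN; last exact: ideal_mull.
  by rewrite mcoeff0 scale0r; apply: ideal0.
move=> JPhi; have [s ep] := spanS p; have iE := ext_ideal J L.
rewrite -[p](subrK (\sum_(x <- s) alpha x.1 * beta (N x.2))).
apply: (idealD iE).
  rewrite ep -sumrB; apply: ideal_sum => // x _; rewrite -mulrBr -rmorphB.
  by apply: (@ideal_mull _ _ _ _ iE); apply: ext_r.
pose k := (\max_(x <- s) msize (N x.2))%N.
have -> : \sum_(x <- s) alpha x.1 * beta (N x.2) =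
    \sum_(u : 'X_{1..m < k}) alpha (Phi u p) * beta 'X_[u].
  have -> : \sum_(u : 'X_{1..m < k}) alpha (Phi u p) * beta 'X_[u] =
    \sum_(u : 'X_{1..m < k}) \sum_(x <- s) alpha ((N x.2)@_u *: x.1) * beta 'X_[u].
    apply: eq_bigr => u _; rewrite ep !raddf_sum mulr_suml /=.
    by apply: eq_bigr => x _; rewrite PhiE.
  rewrite exchange_big /= big_seq_cond [RHS]big_seq_cond.
  apply: eq_bigr => x /andP[xs _]; have szk : (msize (N x.2) <= k)%N.
    exact: (@leq_bigmax_seq _ _ xpredT (fun x => msize (N x.2))).
  rewrite {1}(mpolywE szk) raddf_sum mulr_sumr; apply: eq_bigr => u _.
  rewrite -!mul_mpolyC !rmorphM /= scalS; ring.
by apply: (ideal_sum _ iE) => u _; apply: (@ideal_mulr _ _ _ _ iE); apply: ext_l.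
Qed.

Lemma ext_nzd J L f : is_ideal J -> is_ideal L ->
  nzd J f -> nzd (ext J L) (alpha f).
Proof.
move=> iJ iL nf p; have [Phi [PhiM PhiE _]] := ext_coords iL.
move=> /(PhiE _ _ iJ) Jp; apply/(PhiE _ _ iJ) => u.
by apply: nf; rewrite -PhiM.
Qed.

Lemma ext_mul J L a b : is_ideal J -> is_ideal L ->
  ~ J a -> ~ L b -> ~ ext J L (alpha a * beta b).
Proof.
move=> iJ iL nJa nLb; have [Phi [_ PhiE /(_ b nLb)]] := ext_coords iL.
move=> [u [c [c0 Pc]]] /(PhiE _ _ iJ) /(_ u); rewrite Pc => Jca.
by apply: nJa; rewrite -[a]scale1r -(mulVf c0) -scalerA; apply: idealZ.
Qed.

End Tensor.

Lemma ext_swap (K : fieldType) (n m : nat) (S : comNzRingType)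
  (alpha : {rmorphism {mpoly K[n]} -> S}) (beta : {rmorphism {mpoly K[m]} -> S})
  J L : ext alpha beta J L = ext beta alpha L J.
Proof. by rewrite /ext setUC. Qed.

Section TensorDepth.
Variables (K : fieldType) (n m : nat) (S : comNzRingType).
Variables (alpha : {rmorphism {mpoly K[n]} -> S}).
Variables (beta : {rmorphism {mpoly K[m]} -> S}).
Variables (m1 : set {mpoly K[n]}) (m2 : set {mpoly K[m]}).
Hypothesis spanS : spanned alpha beta.
Hypothesis scalS : forall c, alpha c%:MP = beta c%:MP.
Hypothesis contract1 : contractible alpha beta.
Hypothesis contract2 : contractible beta alpha.

Lemma spanned_swap : spanned beta alpha.
Proof.
move=> p; have [s ->] := spanS p; exists [seq (x.2, x.1) | x <- s].
by rewrite big_map; apply: eq_bigr => x _; rewrite mulrC.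
Qed.

(** Concatenating a maximal regular sequence of each factor gives one of the
    tensor product, whose socle contains the product of the two socle
    elements. *)
Lemma depth_tensor r q J L : is_ideal J -> is_ideal L ->
  depth_is m1 r J -> depth_is m2 q L ->
  depth_is (ext alpha beta m1 m2) (r + q) (ext alpha beta J L).
Proof.
move=> iJ iL; elim: r J iJ => [|r IH] J iJ; last first.
  move=> [z [mz nz dz]] dL; exists (alpha z); split; first exact: ext_l.
    exact: ext_nzd.
  by rewrite -ext_adj //; apply: IH => //; apply: adj_ideal.
move=> [a nJa Ja]; elim: q L iL => [|q IH] L iL.
  move=> [b nLb Lb]; exists (alpha a * beta b); first exact: ext_mul.
  have iE := ext_ideal alpha beta J L.
  have iW := colon_ideal (alpha a * beta b) iE.
  apply: gen_sub iW _ => _ [[t mt <-]|[t mt <-]]; rewrite /colon /=.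
    by rewrite mulrA -rmorphM; apply: (@ideal_mulr _ _ _ _ iE); apply: ext_l; apply: Ja.
  rewrite mulrCA -rmorphM; apply: (@ideal_mull _ _ _ _ iE); apply: ext_r; exact: Lb.
move=> [z [mz nz dz]]; exists (beta z); split; first exact: ext_r.
  by rewrite ext_swap; apply: ext_nzd => //; apply: spanned_swap.
rewrite [ext alpha beta J L]ext_swap -ext_adj // [ext beta alpha _ _]ext_swap.
apply: IH => //; exact: adj_ideal.
Qed.

End TensorDepth.
(** * The polynomial ring in two disjoint sets of variables *)

Section Embeddings.
Variables (K : fieldType) (n m : nat).
Local Notation S1 := {mpoly K[n]}.
Local Notation S2 := {mpoly K[m]}.
Local Notation S := {mpoly K[n + m]}.
Local Notation ex := (@embed_x K n m).
Local Notation ey := (@embed_y K n m).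

HB.instance Definition _ :=
  GRing.RMorphism.copy ex (comp_mpoly [tuple 'X_(lshift m i) | i < n]).
HB.instance Definition _ :=
  GRing.Linear.copy ex (comp_mpoly [tuple 'X_(lshift m i) | i < n]).
HB.instance Definition _ :=
  GRing.RMorphism.copy ey (comp_mpoly [tuple 'X_(rshift n j) | j < m]).
HB.instance Definition _ :=
  GRing.Linear.copy ey (comp_mpoly [tuple 'X_(rshift n j) | j < m]).

Definition mnx (u : 'X_{1..n + m}) : 'X_{1..n} :=
  [multinom u (lshift m i) | i < n].
Definition mny (u : 'X_{1..n + m}) : 'X_{1..m} :=
  [multinom u (rshift n j) | j < m].
Definition mxy (a : 'X_{1..n}) (b : 'X_{1..m}) : 'X_{1..n + m} :=
  [multinom match split k with inl i => a i | inr j => b j end | k < n + m].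

Lemma mxy_l a b i : mxy a b (lshift m i) = a i.
Proof. by rewrite mnmE (unsplitK (inl i)). Qed.

Lemma mxy_r a b j : mxy a b (rshift n j) = b j.
Proof. by rewrite mnmE (unsplitK (inr j)). Qed.

Lemma mnx_mxy a b : mnx (mxy a b) = a.
Proof. by apply/mnmP => i; rewrite mnmE mxy_l. Qed.

Lemma mny_mxy a b : mny (mxy a b) = b.
Proof. by apply/mnmP => i; rewrite mnmE mxy_r. Qed.

Lemma mxyK u : mxy (mnx u) (mny u) = u.
Proof.
by apply/mnmP => k; case: (split_ordP k) => [i|j] ->;
  rewrite ?mxy_l ?mxy_r mnmE.
Qed.

Lemma mnxD u v : mnx (u + v) = (mnx u + mnx v)%MM.
Proof. by apply/mnmP => i; rewrite !mnmE. Qed.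

Lemma mnyD u v : mny (u + v) = (mny u + mny v)%MM.
Proof. by apply/mnmP => i; rewrite !mnmE. Qed.

Lemma mxyD a b a' b' : (mxy a b + mxy a' b')%MM = mxy (a + a') (b + b').
Proof. by rewrite -[LHS]mxyK mnxD mnyD !mnx_mxy !mny_mxy. Qed.

Lemma lem_mxy a b u : (mxy a b <= u)%MM = (a <= mnx u)%MM && (b <= mny u)%MM.
Proof.
apply/mnm_lepP/andP => [le|[/mnm_lepP lea /mnm_lepP leb] k].
  by split; apply/mnm_lepP => i; rewrite mnmE; [rewrite -(mxy_l a b) | rewrite -(mxy_r a b)].
case: (split_ordP k) => [i|j] ->; rewrite ?mxy_l ?mxy_r.
  by have := lea i; rewrite mnmE.
by have := leb j; rewrite mnmE.
Qed.

Lemma mdeg_mxy a b : mdeg (mxy a b) = (mdeg a + mdeg b)%N.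
Proof.
rewrite !mdegE big_split_ord /=.
by congr (_ + _)%N; apply: eq_bigr => i _; rewrite ?mxy_l ?mxy_r.
Qed.

Lemma embed_xX a : ex 'X_[a] = 'X_[mxy a 0].
Proof.
rewrite /embed_x comp_mpolyX [RHS]mpolyXE_id big_split_ord /=.
rewrite [X in _ * X]big1 ?mulr1 => [|j _]; last by rewrite mxy_r mnm0E.
by apply: eq_bigr => i _; rewrite tnth_mktuple mxy_l.
Qed.

Lemma embed_yX b : ey 'X_[b] = 'X_[mxy 0 b].
Proof.
rewrite /embed_y comp_mpolyX [RHS]mpolyXE_id big_split_ord /=.
rewrite [X in X * _]big1 ?mul1r => [|j _]; last by rewrite mxy_l mnm0E.
by apply: eq_bigr => i _; rewrite tnth_mktuple mxy_r.
Qed.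

Lemma embedXX a b : ex 'X_[a] * ey 'X_[b] = 'X_[mxy a b].
Proof. by rewrite embed_xX embed_yX -mpolyXD mxyD addm0 add0m. Qed.

Lemma embed_spanned : spanned ex ey.
Proof.
move=> p; exists [seq (p@_u *: 'X_[mnx u], 'X_[mny u]) | u <- msupp p].
rewrite big_map [LHS]mpolyE. apply: eq_bigr => u _ /=.
by rewrite linearZ /= -scalerAl embedXX mxyK.
Qed.

Lemma embedC c : ex c%:MP = ey c%:MP.
Proof. by rewrite /embed_x /embed_y !comp_mpolyC. Qed.

Lemma embed_mulE (V : lmodType K) (h : 'X_{1..n + m} -> V) a b :
  mlin h (ex a * ey b) =
  \sum_(u <- msupp a) \sum_(v <- msupp b) (a@_u * b@_v) *: h (mxy u v).
Proof.
rewrite {1}[a]mpolyE {1}[b]mpolyE !raddf_sum mulr_suml raddf_sum.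
apply: eq_bigr => u _; rewrite mulr_sumr raddf_sum; apply: eq_bigr => v _.
rewrite /= !linearZ /= -scalerAl -scalerAr embedXX scalerA linearZ /=.
by rewrite mlinX.
Qed.

Lemma scalar_mpolyE k (phi : {scalar {mpoly K[k]}}) p :
  phi p = \sum_(u <- msupp p) p@_u * phi 'X_[u].
Proof.
rewrite {1}[p]mpolyE linear_sum; apply: eq_bigr => u _.
by rewrite linearZ.
Qed.

Lemma embed_contract_y : contractible ex ey.
Proof.
move=> phi; exists (mlin (fun u => phi 'X_[mny u] *: 'X_[mnx u])) => a b.
apply: etrans (embed_mulE _ a b) _.
rewrite scalar_mpolyE {3}[a]mpolyE exchange_big /=.
rewrite scaler_suml; apply: eq_bigr => v _.
rewrite scaler_sumr; apply: eq_bigr => u _.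
by rewrite mnx_mxy mny_mxy !scalerA; congr (_ *: _); ring.
Qed.

Lemma embed_contract_x : contractible ey ex.
Proof.
move=> phi; exists (mlin (fun u => phi 'X_[mnx u] *: 'X_[mny u])) => b a.
apply: etrans (congr1 (mlin _) (mulrC (ey b) (ex a))) _.
apply: etrans (embed_mulE _ a b) _.
rewrite scalar_mpolyE {3}[b]mpolyE /=.
rewrite scaler_suml; apply: eq_bigr => v _.
rewrite scaler_sumr; apply: eq_bigr => u _.
by rewrite mnx_mxy mny_mxy !scalerA; congr (_ *: _); ring.
Qed.

End Embeddings.
(** * Monomial ideals *)

Section MonomialIdeals.
Variables (K : fieldType) (n : nat).
Local Notation T := {mpoly K[n]}.
Implicit Types (U V M : set 'X_{1..n}) (u v w : 'X_{1..n}).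

(** A monomial ideal is determined by its set of monomials [U], closed under
    multiples; working with [U] makes membership a condition on supports. *)
Definition mon U : set T := [set p | forall u, u \in msupp p -> U u].

Definition upset U := forall u v, U u -> (u <= v)%MM -> U v.

Lemma mon_ideal U : upset U -> is_ideal (mon U).
Proof.
move=> upU; split=> [u|f g Uf Ug u|f g Ug u].
- by rewrite msupp0.
- by move=> /msuppD_le; rewrite mem_cat => /orP[/Uf|/Ug].
move=> /msuppM_le /allpairsP[[a b] /= [_ /Ug Ub ->]].
by apply: upU Ub (lem_addl _ _).
Qed.

Lemma monX U u : mon U 'X_[u] <-> U u.
Proof.
split=> [|Uu v]; first by apply; rewrite msuppX mem_head.
by rewrite msuppX inE => /eqP ->.
Qed.

Lemma monP (I : set T) U p : is_ideal I ->
  (forall u, U u -> I 'X_[u]) -> mon U p -> I p.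
Proof.
move=> iI UI Up; rewrite [p]mpolyE big_seq; apply: (ideal_sum _ iI) => u /Up Uu.
by apply: idealZ => //; apply: UI.
Qed.

Definition multiples M : set 'X_{1..n} := [set v | exists2 u, M u & (u <= v)%MM].

Lemma multiples_upset M : upset (multiples M).
Proof. by move=> u v [a Ma au] uv; exists a => //; apply: lepm_trans uv. Qed.

Lemma monomial_genE M : monomial_gen M = mon (multiples M) :> set T.
Proof.
apply/seteqP; split.
  apply: gen_sub; first exact: mon_ideal (@multiples_upset M).
  by move=> _ [u Mu <-]; apply/monX; exists u => //; apply: lepm_refl.
move=> p; apply: monP; first exact: is_ideal_gen.
move=> v [u Mu uv]; rewrite -(submK uv) mpolyXD; apply: (@ideal_mull _ _ _ _ (is_ideal_gen _)).
by apply: mem_ideal_gen; exists u.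
Qed.

Definition mulm U V : set 'X_{1..n} :=
  [set w | exists u v, [/\ U u, V v & (u + v <= w)%MM]].

Lemma mulm_upset U V : upset (mulm U V).
Proof.
by move=> w w' [u [v [Uu Vv le]]] ww'; exists u, v; split=> //; apply: lepm_trans ww'.
Qed.

Lemma mon_mul U V : ideal_mul (mon U) (mon V) = mon (mulm U V).
Proof.
apply/seteqP; split.
  apply: gen_sub; first exact: mon_ideal (@mulm_upset U V).
  move=> _ [f Uf [g Vg <-]] w /msuppM_le /allpairsP[[a b] /= [/Uf Ua /Vg Vb ->]].
  by exists a, b; split=> //; apply: lepm_refl.
move=> p; apply: monP; first exact: is_ideal_gen.
move=> w [u [v [Uu Vv le]]]; rewrite -(submK le) !mpolyXD; apply: (@ideal_mull _ _ _ _ (is_ideal_gen _)).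
apply: mem_ideal_gen; exists 'X_[u]; first exact/monX.
by exists 'X_[v]; first exact/monX.
Qed.

(** The monomials of the [k]th power of [mon U]. *)
Fixpoint powm U k : set 'X_{1..n} := if k is k'.+1 then mulm U (powm U k') else setT.

Lemma powm_upset U k : upset (powm U k).
Proof. by case: k => [|k] //; apply: mulm_upset. Qed.

Lemma mon_setT : mon setT = [set: T].
Proof. by apply/seteqP; split. Qed.

Lemma mon_powm U k : ideal_pow (mon U) k = mon (powm U k).
Proof. by elim: k => [|k IH] /=; rewrite ?mon_setT // IH mon_mul. Qed.

Definition sqfree_powm U k : set 'X_{1..n} :=
  multiples [set u | squarefree u /\ powm U k u].

Lemma mon_sqfree_powm U k : sqfree_pow (mon U) k = mon (sqfree_powm U k).
Proof.
rewrite /sqfree_pow monomial_genE; congr (mon (multiples _)).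
apply/seteqP; split=> u [su Iu]; split=> //; move: Iu; rewrite mon_powm.
  by move=> /monX.
by move=> /monX.
Qed.

Lemma nzd_monX U v : (forall w, U (w + v)%MM -> U w) -> nzd (mon U) ('X_[v] : T).
Proof.
move=> Uv p Up w wp; apply: Uv; apply: Up.
by rewrite mulrC (perm_mem (msuppMX _ _)); apply/mapP; exists w => //; rewrite addmC.
Qed.

Lemma adj_monX U v : upset U ->
  adj (mon U) ('X_[v] : T) = mon (U `|` [set w | (v <= w)%MM]).
Proof.
move=> upU; have iU := mon_ideal upU; have iA := adj_ideal ('X_[v] : T) iU.
have upV : upset (U `|` [set w | (v <= w)%MM]).
  move=> a b [Ua|/= va] ab; first by left; apply: upU ab.
  by right; apply: lepm_trans ab.
apply/seteqP; split.
  apply: adj_sub; first exact: mon_ideal.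
    by move=> p Up u /Up; left.
  by apply/monX; right; apply: lepm_refl.
move=> p; apply: monP => // u [Uu|/= vu]; first by apply: sub_adj; apply/monX.
by rewrite -(submK vu) mpolyXD; apply: (@ideal_mull _ _ _ _ iA); apply: mem_adj.
Qed.

Lemma mon0 : mon set0 = [set 0 : T].
Proof.
apply/seteqP; split=> p /=; last by move=> -> u; rewrite msupp0.
move=> p0; apply/eqP/negPn/negP => /mlead_supp /p0 //.
Qed.

Lemma nonzero_upset : upset [set u | u != 0%MM].
Proof.
move=> u v /= u0 uv; apply: contraNneq u0 => v0.
by apply/eqP/mnmP => i; move/mnm_lepP/(_ i): uv; rewrite v0 mnm0E leqn0 => /eqP.
Qed.

Lemma max_idealE : @max_ideal K n = mon [set u | u != 0%MM].
Proof.
apply/seteqP; split.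
  apply: gen_sub; first exact: mon_ideal nonzero_upset.
  by move=> _ [i _ <-]; apply/monX; rewrite /= mnm1_eq0.
move=> p; apply: monP; first exact: is_ideal_gen.
move=> u /= u0; have [i ui] : exists i, u i != 0%N.
  apply: contrapT => no; move/negP: u0; apply; apply/eqP/mnmP => i.
  by rewrite mnm0E; apply/eqP/negPn/negP => ui; apply: no; exists i.
have le : (U_(i) <= u)%MM by rewrite lep1mP.
rewrite -(submK le) mpolyXD; apply: (@ideal_mull _ _ _ _ (is_ideal_gen _)).
by apply: mem_ideal_gen; exists i.
Qed.

Lemma max_ideal_proper : ~ @max_ideal K n 1.
Proof. by rewrite max_idealE -mpolyX0 => /monX /=; rewrite eqxx. Qed.

Lemma max_ideal_ideal : is_ideal (@max_ideal K n).
Proof. exact: is_ideal_gen. Qed.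

(** The variables form a regular sequence: [mon (U k)] is the prime ideal of the
    variables of index at least [k], and the sequence is read from the last
    variable to the first. *)
Lemma depth_mpoly : depth_is (@max_ideal K n) n ([set 0] : set T).
Proof.
pose U k : set 'X_{1..n} := [set u | exists2 i : 'I_n, (k <= i)%N & u i != 0%N].
have upU k : upset (U k).
  move=> u v [i ki ui] /mnm_lepP /(_ i) uv; exists i => //.
  by rewrite -lt0n; apply: leq_trans uv; rewrite lt0n.
have -> : [set 0] = mon (U n).
  rewrite -mon0; congr mon; apply/seteqP; split=> // u [i].
  by rewrite leqNgt ltn_ord.
suff H k : (k <= n)%N -> depth_is (@max_ideal K n) k (mon (U k)) by exact: H.
elim: k => [_|k IH kn].
  exists 1.
    by rewrite -mpolyX0 => /monX [i _]; rewrite mnm0E.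
  move=> t; rewrite mulr1 max_idealE => mt u /mt /= u0.
  apply: contrapT => no; move/negP: u0; apply; apply/eqP/mnmP => i.
  by rewrite mnm0E; apply/eqP/negPn/negP => ui; apply: no; exists i.
exists 'X_(Ordinal kn); split.
- by rewrite max_idealE; apply/monX; rewrite /= mnm1_eq0.
- apply: nzd_monX => w [i ki wi]; exists i => //; move: wi.
  rewrite mnmDE mnm1E; case: (Ordinal kn =P i) => [e|_]; last by rewrite /= addn0.
  by move: ki; rewrite -e ltnn.
rewrite adj_monX //.
rewrite (_ : _ `|` _ = U k); first exact: IH (ltnW kn).
apply/seteqP; split=> u.
  move=> [[i ki ui]|/=]; first by exists i => //; apply: ltnW.
  by rewrite lep1mP; exists (Ordinal kn).
move=> [i]; rewrite leq_eqVlt => /predU1P[ki ui|ki ui].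
  right; rewrite /= lep1mP; congr (_ != _): ui; congr (u _).
  by apply: val_inj => /=.
by left; exists i.
Qed.

Lemma depth_quotE r (J : set T) : is_ideal J -> J `<=` @max_ideal K n ->
  depth_is (@max_ideal K n) r J -> depth_quot J = r.
Proof.
move=> iJ Jm dJ; apply: nat_maxE.
  exact: (depth_regular max_ideal_ideal max_ideal_proper iJ Jm dJ).
move=> e [s [<- ms rs]].
exact: (regular_le_depth (@mpoly_noetherian K n) max_ideal_ideal iJ dJ).
Qed.

(** A monomial of least degree in [U] is a minimal generator. *)
Lemma indegE U u0 : upset U -> U u0 ->
  (forall u, U u -> (mdeg u0 <= mdeg u)%N) -> indeg (mon U) = mdeg u0.
Proof.
move=> upU Uu0 minu0; apply: nat_minE; last by move=> _ [u [/monX /minu0 ? _] <-].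
exists u0 => //; split; first exact/monX.
move=> v /monX /minu0 vu0 le.
have := mdegD (u0 - v) v; rewrite (submK le) => e.
have /eqP : mdeg (u0 - v)%MM = 0%N.
  by apply/eqP; rewrite -leqn0 -(leq_add2r (mdeg v)) -e add0n.
by rewrite mdeg_eq0 => /eqP e0; rewrite -(submK le) e0 add0m.
Qed.

Lemma min_mdeg_ex U : (exists u, U u) ->
  exists2 u0, U u0 & forall u, U u -> (mdeg u0 <= mdeg u)%N.
Proof.
move=> [u Uu]; have [d] := ubnP (mdeg u); elim: d u Uu => // d IH u Uu.
rewrite ltnS => ud.
have [[v Uv vu]|no] := pselect (exists2 v, U v & (mdeg v < mdeg u)%N).
  by apply: IH Uv _; apply: leq_trans ud.
exists u => // v Uv; rewrite leqNgt; apply/negP => vu.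
by apply: no; exists v.
Qed.

End MonomialIdeals.
(** * Nonzero ideals have depth less than the number of variables *)

Section DimensionBound.
Variables (K : fieldType) (n : nat).
Local Notation T := {mpoly K[n]}.
Implicit Types (I : set T) (A B : finType).

Definition indep I A (f : A -> T) := forall c : A -> K,
  I (\sum_a c a *: f a) -> forall a, c a = 0.

(** A relation between the [z ^+ i * f a] modulo [I] reduces modulo [z] to one
    between the [f a]; once those coefficients vanish, [z] can be cancelled. *)
Lemma indep_powers I z A (f : A -> T) t : is_ideal I -> nzd I z ->
  indep (adj I z) f -> indep I (fun x : 'I_t * A => z ^+ x.1 * f x.2).
Proof.
move=> iI nz indf c Ic.
suff H : forall t (c : nat -> A -> K), I (\sum_(i < t) \sum_a c i a *: (z ^+ i * f a)) ->
    forall i a, (i < t)%N -> c i a = 0.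
  move=> [i a]; case: t i c Ic => [[]|t] // i c Ic.
  have := H t.+1 (fun j b => c (inord j, b)) _ i a (ltn_ord i).
  rewrite /= inord_val; apply.
  rewrite [X in I X](_ : _ = \sum_x c x *: (z ^+ x.1 * f x.2)) //.
  rewrite pair_bigA /=; apply: eq_bigr => -[j b] _ /=; by rewrite inord_val.
move=> {t c Ic}; elim=> // t IH c.
rewrite big_ord_recl /=.
have -> : \sum_(i < t) \sum_a c (bump 0 i) a *: (z ^+ bump 0 i * f a) =
  z * \sum_(i < t) \sum_a c i.+1 a *: (z ^+ i * f a).
  rewrite mulr_sumr; apply: eq_bigr => i _; rewrite mulr_sumr.
  by apply: eq_bigr => a _; rewrite -scalerAr mulrA -exprS.
under eq_bigr do rewrite expr0 mul1r.
set X := \sum_a _; set Y := \sum_(i < t) _ => Ic.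
have c0 a : c 0%N a = 0.
  apply: (indf (c 0%N)); rewrite -/X; exists (X + z * Y), (- Y).
  by split=> //; ring.
have X0 : X = 0 by rewrite /X big1 // => a _; rewrite c0 scale0r.
move: Ic; rewrite X0 add0r => /nz IY [|i] a //.
by rewrite ltnS; apply: (IH (fun j => c j.+1)).
Qed.

(** The products of powers below [t] of the terms of a regular sequence of length
    [r] are [t ^ r] elements, independent modulo [I], of degree linear in
    [t]. *)
Lemma indep_depth (m : set T) r I : ~ m 1 -> is_ideal I -> I `<=` m ->
  is_ideal m -> depth_is m r I ->
  exists D, forall t, (0 < t)%N -> exists (A : finType) (f : A -> T),
    [/\ #|A| = (t ^ r)%N, indep I f & forall a, (msize (f a) <= D * t)%N].
Proof.
move=> nm1 iI Im im; elim: r I iI Im => [|r IH] I iI Im.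
  move=> _; exists 1%N => t t0; exists 'I_1, (fun _ => 1); split.
  - by rewrite card_ord.
  - move=> c; rewrite big_ord1 => Ic a; rewrite ord1.
    apply/eqP/negPn/negP => c0; apply: nm1; apply: Im.
    by rewrite -[1]scale1r -(mulVf c0) -scalerA; apply: idealZ.
  - by move=> _; rewrite msize1 mul1n.
move=> [z [mz nz /IH []]]; [exact: adj_ideal|exact: adj_sub|].
move=> D DP; exists (D + msize z)%N => t t0; have [A [f [cA indf szf]]] := DP t t0.
exists ('I_t * A)%type, (fun x : 'I_t * A => z ^+ x.1 * f x.2); split.
- by rewrite card_prod card_ord cA expnS.
- exact: indep_powers.
move=> [i a] /=.
have szX k : (msize (z ^+ k * f a) <= k * msize z + D * t)%N.
  elim: k => [|k IHk]; first by rewrite expr0 mul1r; apply: szf.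
  have [->|z0] := eqVneq z 0; first by rewrite exprS !mul0r msize0.
  rewrite exprS -mulrA.
  have [->|zk0] := eqVneq (z ^+ k * f a) 0; first by rewrite mulr0 msize0.
  rewrite msizeM // (leq_trans (leq_pred _)) //.
  by rewrite mulSn -addnA leq_add2l.
apply: leq_trans (szX i) _; rewrite mulnDl addnC leq_add2l mulnC.
by rewrite leq_mul2l ltnW ?orbT.
Qed.

(** A polynomial of [msize] at most [d] only involves monomials with exponents
    less than [d], of which there are [d ^ n]. *)
Lemma indep_card A (f : A -> T) d : indep [set 0] f ->
  (forall a, (msize (f a) <= d)%N) -> (#|A| <= d ^ n)%N.
Proof.
move=> indf szf; rewrite leqNgt; apply/negP => lt.
pose B := {ffun 'I_n -> 'I_d}.
pose M := \matrix_(a < #|A|, b < #|B|)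
  (f (enum_val a))@_[multinom val (enum_val b i) | i < n].
have [v v0 vM] : exists2 v : 'rV_#|A|, v != 0 & v *m M = 0.
  have : kermx M != 0.
    rewrite -mxrank_eq0 mxrank_ker subn_eq0 -ltnNge.
    apply: leq_ltn_trans (rank_leq_col _) _.
    by rewrite card_ffun !card_ord.
  move=> /rowV0Pn [v /sub_kermxP vM v0]; by exists v.
move/negP: v0; apply; apply/eqP/rowP => a; rewrite mxE.
suff : v 0 (enum_rank (enum_val a)) = 0 by rewrite enum_valK.
apply: (indf (fun a => v 0 (enum_rank a))) => /=; apply/mpolyP => u.
rewrite mcoeff0 raddf_sum /=.
have [ud|] := boolP [forall i, u i < d]%N; last first.
  rewrite negb_forall => /existsP[i]; rewrite -leqNgt => du.
  rewrite big1 // => b _; rewrite mcoeffZ memN_msupp_eq0 ?mulr0 //.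
  apply: msize_mdeg_ge; apply: leq_trans (szf b) _; apply: leq_trans du _.
  by rewrite mdegE (bigD1 i) //= leq_addr.
pose b : B := [ffun i => Ordinal (forallP ud i)].
have ub : [multinom val (enum_val (enum_rank b) i) | i < n] = u.
  by apply/mnmP => i; rewrite mnmE enum_rankK ffunE.
have /rowP /(_ (enum_rank b)) := vM; rewrite !mxE => e; rewrite -[RHS]e.
rewrite [LHS](reindex _ (onW_bij _ (@enum_val_bij A))) /=. apply: eq_bigr => c _.
by rewrite enum_valK !mxE mcoeffZ ub.
Qed.

(** If [n <= r], the powers of [h] prolong the family of [indep_depth]: being
    independent modulo [I], it is independent modulo [(h)], so together they give
    [t ^ r.+1] independent polynomials with exponents less than [E * t], more
    than the [(E * t) ^ n] available monomials as soon as [E ^ n < t]. *)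
Lemma depth_lt_dim (m : set T) r I h : ~ m 1 -> is_ideal I -> I `<=` m ->
  is_ideal m -> depth_is m r I -> I h -> h != 0 -> (r < n)%N.
Proof.
move=> nm1 iI Im im dI Ih h0; rewrite ltnNge; apply/negP => nr.
have [D DP] := indep_depth nm1 iI Im im dI.
pose E := (D + msize h)%N; pose t := (E ^ n).+1.
have t0 : (0 < t)%N by [].
have [A [f [cA indf szf]]] := DP t t0.
have i0 := zero_ideal T.
have nh : nzd [set 0] h.
  by move=> p /= /eqP; rewrite mulf_eq0 (negbTE h0) => /eqP.
have indh : indep (adj [set 0] h) f.
  move=> c hc; apply: indf; move: hc; apply: adj_sub => //.
  by move=> _ ->; apply: ideal0.
have ind0 := indep_powers (t := t) i0 nh indh.
have szX k a : (msize (h ^+ k * f a) <= k * msize h + D * t)%N.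
  elim: k => [|k IHk]; first by rewrite expr0 mul1r; apply: szf.
  rewrite exprS -mulrA.
  have [->|zk0] := eqVneq (h ^+ k * f a) 0; first by rewrite mulr0 msize0.
  rewrite msizeM // (leq_trans (leq_pred _)) //.
  by rewrite mulSn -addnA leq_add2l.
have := @indep_card _ _ (E * t) ind0; rewrite card_prod card_ord cA.
have sz : forall a : 'I_t * A, (msize (h ^+ a.1 * f a.2) <= E * t)%N.
  move=> [i a] /=; apply: leq_trans (szX i a) _.
  rewrite mulnDl addnC leq_add2l mulnC.
  by rewrite leq_mul2l ltnW ?orbT.
move=> /(_ sz); rewrite expnMn leqNgt => /negP; apply.
rewrite (@leq_trans (t * t ^ n)) ?leq_mul2l ?leq_pexp2l ?orbT //.
by rewrite ltn_mul2r expn_gt0 t0 /= ltnSn.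
Qed.

End DimensionBound.
(** * Monomial grade and coprime monomials *)

Section Grade.
Variables (K : fieldType) (n : nat).
Local Notation T := {mpoly K[n]}.
Implicit Types (U V M : set 'X_{1..n}) (u v w : 'X_{1..n}).

(** The sets of monomials of the proper ideals generated by squarefree
    monomials. *)
Definition sqfree_gen U := [/\ upset U, ~ U 0%MM &
  forall u, U u -> exists v, [/\ U v, squarefree v & (v <= u)%MM]].

Lemma sqfree_idealP (I : set T) : squarefree_monomial_ideal I ->
  exists U, [/\ sqfree_gen U, I = mon U & exists u, U u].
Proof.
move=> [[M sM ->] n0 nT]; move: n0 nT; rewrite monomial_genE => n0 nT.
have upM := @multiples_upset n M.
exists (multiples M); split=> //.
  split=> // [M0|u [v Mv vu]].
    apply: nT; apply/seteqP; split=> // p _ u _; apply: upM M0 _.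
    by apply/mnm_lepP => i; rewrite mnm0E.
  exists v; split=> //; last exact: sM.
  by exists v => //; apply: lepm_refl.
apply: contrapT => no; apply: n0; rewrite -mon0; congr mon.
by apply/seteqP; split=> // u Uu; apply: no; exists u.
Qed.

Definition mcoprime u v := [forall c, (u c == 0%N) || (v c == 0%N)].

Lemma mcoprimeP u v : reflect (forall c, u c = 0%N \/ v c = 0%N) (mcoprime u v).
Proof.
apply: (iffP forallP) => H c; first by case/orP: (H c) => /eqP; [left|right].
by apply/orP; case: (H c) => ->; [left|right].
Qed.

Lemma mcoprime_le u v u' v' : (u' <= u)%MM -> (v' <= v)%MM ->
  mcoprime u v -> mcoprime u' v'.
Proof.
move=> /mnm_lepP leu /mnm_lepP lev /mcoprimeP cop; apply/mcoprimeP => c.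
have := leu c; have := lev c; case: (cop c) => ->; rewrite !leqn0.
  by move=> _ /eqP; left.
by move=> /eqP; right.
Qed.

Lemma mcoprime_sym u v : mcoprime u v = mcoprime v u.
Proof. by apply: eq_forallb => c; rewrite orbC. Qed.

Lemma gen_monX (us : seq 'X_{1..n}) :
  ideal_gen ([set 0] `|` [set` [seq ('X_[u] : T) | u <- us]]) = mon (multiples [set` us]).
Proof.
rewrite -monomial_genE; apply/seteqP; split.
  apply: gen_sub; first exact: is_ideal_gen.
  move=> _ [->|/= /mapP[u uus ->]]; first by apply: ideal0; apply: is_ideal_gen.
  by apply: mem_ideal_gen; exists u.
apply: gen_mono => _ [u /= uus <-]; right; exact: map_f.
Qed.

(** Let [ui] and [uj] be terms with [i < j].  The [j]th term multiplies
    [ui / gcd(ui, uj)] into the ideal of the previous terms, so some previous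
    [ul] divides [ui / gcd(ui, uj)].  If [l = i] the gcd is 1; otherwise [ul]
    divides [ui] while being coprime to it by induction, so [ul = 1], which is
    impossible. *)
Lemma regular_monomials us :
  regular_seq [set 0] [seq ('X_[u] : T) | u <- us] ->
  (forall u, u \in us -> u != 0%MM) /\ pairwise mcoprime us.
Proof.
move=> [reg n1].
have us0 u : u \in us -> u != 0%MM.
  move=> uus; apply/eqP => u0; apply: n1; rewrite gen_monX -mpolyX0.
  by apply/monX; exists u => //; rewrite u0 lepm_refl.
split=> //; apply/(pairwiseP 0%MM) => i j _; rewrite !inE => ju ij.
elim/ltn_ind: j i ju ij => j IH i ju ij.
have iu := ltn_trans ij ju.
set ui := nth _ us i; set uj := nth _ us j.
have le_i : (ui <= (ui - uj) + uj)%MM.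
  by apply/mnm_lepP => c; rewrite mnmDE mnmBE addnC -leq_subLR.
have : mon (multiples [set` take j us]) ('X_[ui - uj] : T).
  have := reg j; rewrite size_map => /(_ ju 'X_[ui - uj]).
  rewrite -map_take gen_monX (nth_map 0%MM) // -/uj -mpolyXD; apply.
  apply/monX; exists ui; last by rewrite addmC.
  by rewrite /= /ui -(nth_take _ ij) mem_nth // size_takel // ltnW.
move=> /monX [v /= /(nthP 0%MM) [l]]; rewrite size_takel ?(ltnW ju) // => lj.
rewrite nth_take // => <- {v} le_l.
have lu := ltn_trans lj ju.
have le_li : (nth 0 us l <= ui)%MM by apply: lepm_trans le_l (lem_subr _ _).
have [eil|nil] := eqVneq l i.
  apply/mcoprimeP => c; move/mnm_lepP/(_ c): le_l; rewrite eil -/ui mnmBE.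
  case: (ui c) => [|a]; first by left.
  by case: (uj c) => [|b]; [right | rewrite subSS ltnNge leq_subr].
have cop : mcoprime (nth 0%MM us l) ui.
  move: nil; rewrite neq_ltn => /orP[li|il]; first exact: IH.
  by rewrite mcoprime_sym; apply: IH.
have := us0 _ (mem_nth 0%MM lu); case/negP; apply/eqP/mnmP => c; rewrite mnm0E.
case/mcoprimeP/(_ c): cop => // uic.
by move/mnm_lepP/(_ c): le_li; rewrite uic leqn0 => /eqP.
Qed.

(** The induction adjoins the monomials one by one, remembering that the remaining
    ones are nonzerodivisors modulo the monomial ideal [mon U] built so far. *)
Lemma monomials_regular us : (forall u, u \in us -> u != 0%MM) ->
  pairwise mcoprime us -> regular_seq [set 0] [seq ('X_[u] : T) | u <- us].
Proof.
suff H : forall U, upset U -> ~ U 0%MM ->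
    (forall u w, u \in us -> U (w + u)%MM -> U w) ->
    (forall u, u \in us -> u != 0%MM) -> pairwise mcoprime us ->
    regular_seq (mon U) [seq ('X_[u] : T) | u <- us].
  by rewrite -mon0; apply: (H set0) => [u v []|[]|u w _ []].
elim: us => [|u us IH] U upU nU0 nzU us0 /=.
  move=> _; apply/regular_nil; first exact: mon_ideal.
  by rewrite -mpolyX0 => /monX.
move=> /andP[/allP copu copus]; apply/regular_cons; first exact: mon_ideal.
split.
  by apply: nzd_monX => w; apply: nzU; rewrite mem_head.
rewrite adj_monX //; apply: IH => //.
- move=> a b [Ua|/= ua] ab; first by left; apply: upU ab.
  by right; apply: lepm_trans ab.
- case=> //= u0; have /negP := us0 u (mem_head _ _); apply.
  apply/eqP/mnmP => c; move/mnm_lepP/(_ c): u0.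
  by rewrite mnm0E leqn0 => /eqP.
- move=> v w vus [Uw|/mnm_lepP uw].
    by left; apply: nzU Uw; rewrite inE vus orbT.
  right; apply/mnm_lepP => c; have := uw c; rewrite mnmDE.
  by case/mcoprimeP/(_ c): (copu v vus) => -> //; rewrite addn0.
- by move=> v vus; apply: us0; rewrite inE vus orbT.
Qed.

Lemma squarefreeD u v : squarefree u -> squarefree v -> mcoprime u v ->
  squarefree (u + v)%MM.
Proof.
move=> su sv /mcoprimeP cop c; rewrite mnmDE.
by case: (cop c) => ->; rewrite ?addn0 ?add0n; [exact: sv | exact: su].
Qed.

(** Each of the coprime monomials has a squarefree divisor in [U]; the product of
    these divisors is squarefree. *)
Lemma powm_of_coprime U us : sqfree_gen U -> (forall u, u \in us -> U u) ->
  pairwise mcoprime us -> exists u, squarefree u /\ powm U (size us) u.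
Proof.
move=> [upU nU0 sqU] Uus cop.
suff [u [su pu _]] : exists u, [/\ squarefree u, powm U (size us) u &
    forall v, all (mcoprime v) us -> mcoprime v u] by exists u.
elim: us Uus cop => [|u us IH] Uus /=.
  move=> _; exists 0%MM; split=> // [c|v _]; first by rewrite mnm0E.
  by apply/mcoprimeP => c; right; rewrite mnm0E.
move=> /andP[copu copus].
have [|w [sw pww copw]] := IH _ copus.
  by move=> v vus; apply: Uus; rewrite inE vus orbT.
have [v [Uv sv vu]] := sqU u (Uus u (mem_head _ _)).
have covw : mcoprime v w by apply: mcoprime_le vu (lepm_refl _) (copw _ copu).
exists (v + w)%MM; split; first exact: squarefreeD.
  by exists v, w; split=> //; apply: lepm_refl.
move=> x /andP[/mcoprimeP cxu /copw /mcoprimeP cxw]; apply/mcoprimeP => c.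
case: (cxu c) => [->|uc0]; first by left.
case: (cxw c) => [->|wc0]; first by left.
right; rewrite mnmDE wc0 addn0; apply/eqP; rewrite -leqn0 -uc0.
exact/mnm_lepP.
Qed.

(** Factors of a squarefree monomial are pairwise coprime. *)
Lemma coprime_of_powm U k u : squarefree u -> powm U k u ->
  exists us, [/\ size us = k, forall v, v \in us -> U v & pairwise mcoprime us].
Proof.
move=> su pu.
suff [us [ss Uus cop _]] : exists us, [/\ size us = k, forall v, v \in us -> U v,
    pairwise mcoprime us & forall v, v \in us -> (v <= u)%MM] by exists us.
elim: k u su pu => [|k IH] u su; first by exists [::].
move=> [v [w [Uv pwk le]]].
have sw : squarefree w.
  by move=> c; apply: leq_trans (su c); move/mnm_lepP/(_ c): le;
     rewrite mnmDE; apply: leq_trans; rewrite leq_addl.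
have [us [ss Uus cop leus]] := IH w sw pwk.
exists (v :: us); split=> /=; first by rewrite ss.
- by move=> x; rewrite inE => /predU1P[->|/Uus].
- rewrite cop andbT; apply/allP => x xus; apply/mcoprimeP => c.
  have := leus x xus => /mnm_lepP /(_ c); have := su c.
  move/mnm_lepP/(_ c): le; rewrite mnmDE.
  case: (v c) => [|a]; first by left.
  case: (w c) => [|b]; first by move=> _ _; rewrite leqn0 => /eqP; right.
  by rewrite addSn addnS => lt1 lt2; have := leq_trans lt1 lt2.
move=> x; rewrite inE => /predU1P[->|/leus xw].
  exact: lepm_trans (lem_addr _ _) le.
exact: lepm_trans xw (lepm_trans (lem_addl _ _) le).
Qed.

Lemma powm_mdeg U k u : ~ U 0%MM -> powm U k u -> (k <= mdeg u)%N.
Proof.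
move=> nU0; elim: k u => // k IH u [v [w [Uv /IH kw le]]].
have v0 : (0 < mdeg v)%N.
  by rewrite lt0n mdeg_eq0; apply/eqP => v0; apply: nU0; rewrite -v0.
rewrite -(submK le) mdegD mdegD; apply: leq_trans (leq_addl _ _).
by rewrite -add1n leq_add.
Qed.

Lemma powmS U k u : powm U k.+1 u -> powm U k u.
Proof.
by move=> [v [w [_ pwk le]]]; apply: powm_upset pwk _; apply: lepm_trans le; apply: lem_addl.
Qed.

Lemma powm_le U k l u : (k <= l)%N -> powm U l u -> powm U k u.
Proof.
elim: l => [|l IH]; first by rewrite leqn0 => /eqP ->.
by rewrite leq_eqVlt => /predU1P[->//|kl /powmS]; apply: IH.
Qed.

Lemma squarefree_mdeg u : squarefree u -> (mdeg u <= n)%N.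
Proof.
move=> su; rewrite mdegE -[X in (_ <= X)%N]card_ord -sum1_card.
exact: leq_sum.
Qed.

(** Monomial regular sequences are sequences of coprime monomials, so their
    possible lengths form an initial segment of the integers, bounded by the
    number of variables because the factors of a squarefree monomial are
    nonconstant. *)
Lemma monomial_gradeP U k : sqfree_gen U ->
  (k <= monomial_grade (mon U : set T))%N <-> exists u, squarefree u /\ powm U k u.
Proof.
move=> gU; have [upU nU0 sqU] := gU.
pose A : set nat := [set r | exists us : seq 'X_{1..n},
    [/\ size us = r, (forall u, u \in us -> (mon U : set T) 'X_[u])
      & regular_seq [set 0] [seq ('X_[u] : T) | u <- us]]].
have AP r : A r <-> exists u, squarefree u /\ powm U r u.
  split.
    move=> [us [<- Uus /regular_monomials [_ cop]]].
    by apply: powm_of_coprime => // u /Uus /monX.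
  move=> [u [su pu]]; have [us [ss Uus cop]] := coprime_of_powm su pu.
  exists us; split=> // [v /Uus ?|]; first exact/monX.
  apply: monomials_regular => // v /Uus Uv.
  by apply/eqP => v0; apply: nU0; rewrite -v0.
have Adown i j : (i <= j)%N -> A j -> A i.
  by move=> ij /AP [u [su pu]]; apply/AP; exists u; split=> //; apply: powm_le pu.
have Abound r : A r -> (r <= n)%N.
  move=> /AP [u [su pu]].
  exact: leq_trans (powm_mdeg nU0 pu) (squarefree_mdeg su).
have A0 : A 0%N.
  by apply/AP; exists 0%MM; split=> // c; rewrite mnm0E.
have [d Ad dmax] : exists2 d, A d & forall e, A e -> (e <= d)%N.
  suff step g d : A d -> (n - d < g)%N ->
      exists2 d, A d & forall e, A e -> (e <= d)%N.
    exact: step _ _ A0 (ltnSn _).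
  elim: g d => // g IH d Ad gd; have [Ad1|nAd1] := pselect (A d.+1).
    apply: (IH d.+1) => //; rewrite -ltnS subnS prednK //.
    by rewrite subn_gt0; apply: Abound.
  exists d => // e Ae; rewrite leqNgt; apply/negP => de.
  by apply: nAd1; apply: Adown Ae.
rewrite -AP /monomial_grade (nat_maxE Ad dmax); split; last exact: dmax.
by move=> kd; apply: Adown Ad.
Qed.

Lemma sqfree_powm_upset U k : upset (sqfree_powm U k).
Proof. exact: multiples_upset. Qed.

Lemma sqfree_powmP U k : (exists u, sqfree_powm U k u) <-> exists u, squarefree u /\ powm U k u.
Proof.
split=> [[u [v ? _]]|[u ?]]; first by exists v.
by exists u, u => //; apply: lepm_refl.
Qed.

Lemma sqfree_powm_nonzero U k u : sqfree_gen U -> (0 < k)%N -> sqfree_powm U k u -> u != 0%MM.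
Proof.
move=> [_ nU0 _] k0 [v [_ pv] vu]; rewrite -mdeg_eq0 -lt0n.
rewrite -(submK vu) mdegD; apply: leq_trans (leq_addl _ _).
exact: leq_trans (powm_mdeg nU0 pv).
Qed.

End Grade.

(** * Product of squarefree monomial ideals in disjoint variables *)

Section Product.
Variables (K : fieldType) (n m : nat).
Local Notation S := {mpoly K[n + m]}.
Implicit Types (U : set 'X_{1..n}) (V : set 'X_{1..m}).

Definition prodm U V : set 'X_{1..n + m} :=
  [set w | U (mnx w) /\ V (mny w)].

Lemma mnx_le (u v : 'X_{1..n + m}) : (u <= v)%MM -> (mnx u <= mnx v)%MM.
Proof. by move=> /mnm_lepP le; apply/mnm_lepP => i; rewrite !mnmE. Qed.

Lemma mny_le (u v : 'X_{1..n + m}) : (u <= v)%MM -> (mny u <= mny v)%MM.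
Proof. by move=> /mnm_lepP le; apply/mnm_lepP => i; rewrite !mnmE. Qed.

Lemma prodm_upset U V : upset U -> upset V -> upset (prodm U V).
Proof.
move=> upU upV u v [Uu Vu] uv; split.
  exact: upU Uu (mnx_le uv).
exact: upV Vu (mny_le uv).
Qed.

Lemma squarefree_mxy (a : 'X_{1..n}) (b : 'X_{1..m}) : squarefree (mxy a b) <-> squarefree a /\ squarefree b.
Proof.
split=> [sab|[sa sb] k].
  split=> i; first by have := sab (lshift m i); rewrite mxy_l.
  by have := sab (rshift n i); rewrite mxy_r.
by case: (split_ordP k) => [i|j] ->; rewrite ?mxy_l ?mxy_r.
Qed.

Lemma sqfree_gen_prod U V : sqfree_gen U -> sqfree_gen V -> sqfree_gen (prodm U V).
Proof.
move=> [upU nU0 sU] [upV nV0 sV]; split; first exact: prodm_upset.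
  move=> [U0 _]; apply: nU0; apply: upU U0 _.
  by apply/mnm_lepP => i; rewrite !mnmE.
move=> w [/sU [a [Ua sa aw]] /sV [b [Vb sb bw]]].
exists (mxy a b); split; last by rewrite lem_mxy aw.
  by rewrite /prodm /= mnx_mxy mny_mxy.
by apply/squarefree_mxy.
Qed.

(** [k] factors of the x-part and [k] factors of the y-part are paired
    arbitrarily. *)
Lemma powm_prod U V k w : powm (prodm U V) k w <-> powm U k (mnx w) /\ powm V k (mny w).
Proof.
elim: k w => [|k IH] w //=; split.
  move=> [u [v [[Uu Vu] /IH [Uv Vv] le]]].
  split; first by exists (mnx u), (mnx v); rewrite -mnxD mnx_le.
  by exists (mny u), (mny v); rewrite -mnyD mny_le.
move=> [[a [a' [Ua Ua' lea]]] [b [b' [Vb Vb' leb]]]].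
exists (mxy a b), (mxy a' b'); split.
- by rewrite /prodm /= mnx_mxy mny_mxy.
- by apply/IH; rewrite mnx_mxy mny_mxy.
by rewrite mxyD lem_mxy lea.
Qed.

Lemma sqfree_powm_prod U V k : sqfree_powm (prodm U V) k = prodm (sqfree_powm U k) (sqfree_powm V k).
Proof.
apply/seteqP; split=> w.
  move=> [u [su /powm_prod [pU pV]] uw].
  move: su; rewrite -{1}[u]mxyK => /squarefree_mxy [sx sy].
  split; first by exists (mnx u); [split | apply: mnx_le].
  by exists (mny u); [split | apply: mny_le].
move=> [[a [sa pa] aw] [b [sb pb] bw]].
exists (mxy a b); last by rewrite lem_mxy aw.
by split; [apply/squarefree_mxy | apply/powm_prod; rewrite mnx_mxy mny_mxy].
Qed.

Lemma embed_x_mon U : upset U ->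
  ideal_gen (@embed_x K n m @` mon U) = mon [set w | U (mnx w)].
Proof.
move=> upU.
have upx : upset [set w : 'X_{1..n + m} | U (mnx w)].
  by move=> u v /= Uu uv; apply: upU Uu (mnx_le uv).
have iM := mon_ideal K upx.
apply/seteqP; split.
  apply: gen_sub; first exact: mon_ideal.
  move=> _ [p Up <-]; rewrite [p]mpolyE raddf_sum /= big_seq.
  apply: (ideal_sum _ iM) => u /Up Uu; rewrite linearZ /=.
  apply: (idealZ iM); rewrite embed_xX; apply/monX.
  by rewrite /= mnx_mxy.
move=> p; apply: monP; first exact: is_ideal_gen.
move=> w /= Uw; rewrite -[w]mxyK -embedXX.
apply: (@ideal_mulr _ _ _ _ (is_ideal_gen _)); apply: mem_ideal_gen.
by exists 'X_[mnx w] => //; apply/monX.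
Qed.

Lemma embed_y_mon V : upset V ->
  ideal_gen (@embed_y K n m @` mon V) = mon [set w | V (mny w)].
Proof.
move=> upV.
have upy : upset [set w : 'X_{1..n + m} | V (mny w)].
  by move=> u v /= Vu uv; apply: upV Vu (mny_le uv).
have iM := mon_ideal K upy.
apply/seteqP; split.
  apply: gen_sub; first exact: mon_ideal.
  move=> _ [p Vp <-]; rewrite [p]mpolyE raddf_sum /= big_seq.
  apply: (ideal_sum _ iM) => u /Vp Vu; rewrite linearZ /=.
  apply: (idealZ iM); rewrite embed_yX; apply/monX.
  by rewrite /= mny_mxy.
move=> p; apply: monP; first exact: is_ideal_gen.
move=> w /= Vw; rewrite -[w]mxyK -embedXX.
apply: (@ideal_mull _ _ _ _ (is_ideal_gen _)); apply: mem_ideal_gen.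
by exists 'X_[mny w] => //; apply/monX.
Qed.

Lemma mon_prodm U V : mon (prodm U V) =
  mon [set w | U (mnx w)] `&` mon [set w | V (mny w)] :> set S.
Proof.
apply/seteqP; split=> p; first by move=> pUV; split=> u /pUV [].
by move=> [pU pV] u multiples; split; [apply: pU | apply: pV].
Qed.

Lemma disjoint_mul_mon U V : upset U -> upset V ->
  disjoint_mul (mon U) (mon V) = mon (prodm U V) :> set S.
Proof.
move=> upU upV; rewrite /disjoint_mul embed_x_mon // embed_y_mon // mon_mul.
congr mon; apply/seteqP; split=> w.
  move=> [u [v /= [Uu Vv le]]]; split.
    apply: upU Uu _; apply: mnx_le; exact: lepm_trans (lem_addr _ _) le.
  apply: upV Vv _; apply: mny_le; exact: lepm_trans (lem_addl _ _) le.
move=> [Uw Vw]; exists (mxy (mnx w) 0), (mxy 0 (mny w)); split=> /=.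
- by rewrite mnx_mxy.
- by rewrite mny_mxy.
by rewrite mxyD addm0 add0m mxyK lepm_refl.
Qed.

Lemma ext_max : ext (@embed_x K n m) (@embed_y K n m) (@max_ideal K n) (@max_ideal K m)
  = @max_ideal K (n + m).
Proof.
rewrite !max_idealE; apply/seteqP; split; last first.
  move=> p; apply: monP; first exact: is_ideal_gen.
  move=> w /= w0; rewrite -[w]mxyK -embedXX.
  have iE := ext_ideal (@embed_x K n m) (@embed_y K n m).
  have [wx0|wx0] := eqVneq (mnx w) 0%MM.
    apply: (@ideal_mull _ _ _ _ (iE _ _)); apply: ext_r; apply/monX => /=.
    apply: contraNneq w0 => wy0; rewrite -[w]mxyK wx0 wy0; apply/eqP/mnmP => k.
    by rewrite mnm0E; case: (split_ordP k) => [i|j] ->; rewrite ?mxy_l ?mxy_r mnm0E.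
  by apply: (@ideal_mulr _ _ _ _ (iE _ _)); apply: ext_l; apply/monX.
have iM : is_ideal (mon [set w : 'X_{1..n + m} | w != 0%MM] : set S).
  exact: mon_ideal (@nonzero_upset _).
apply: gen_sub => // q [Hq|Hq] w.
  have : mon [set w : 'X_{1..n + m} | mnx w != 0%MM] q.
    rewrite -(embed_x_mon (@nonzero_upset n)).
    exact: mem_ideal_gen.
  by move=> /[apply] /=; apply: contraNneq => ->; apply/eqP/mnmP => i; rewrite !mnmE.
have : mon [set w : 'X_{1..n + m} | mny w != 0%MM] q.
  rewrite -(embed_y_mon (@nonzero_upset m)).
  exact: mem_ideal_gen.
by move=> /[apply] /=; apply: contraNneq => ->; apply/eqP/mnmP => i; rewrite !mnmE.
Qed.

Local Notation extxy := (ext (@embed_x K n m) (@embed_y K n m)).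

Lemma ext_mon0 U : upset U -> extxy (mon U) [set 0] = mon [set w | U (mnx w)].
Proof.
move=> upU; rewrite -embed_x_mon //; apply/seteqP; split; last first.
  by apply: gen_mono; left.
apply: gen_sub; first exact: is_ideal_gen.
move=> p [|[_ -> <-]]; first exact: mem_ideal_gen.
by rewrite raddf0; apply: ideal0; apply: is_ideal_gen.
Qed.

Lemma ext_0mon V : upset V -> extxy [set 0] (mon V) = mon [set w | V (mny w)].
Proof.
move=> upV; rewrite -embed_y_mon //; apply/seteqP; split; last first.
  by apply: gen_mono; right.
apply: gen_sub; first exact: is_ideal_gen.
move=> p [[_ -> <-]|]; last exact: mem_ideal_gen.
by rewrite raddf0; apply: ideal0; apply: is_ideal_gen.
Qed.

Lemma ext_ideal_add J L : J 0 -> L 0 ->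
  ideal_add (extxy J [set 0]) (extxy [set 0] L) = extxy J L.
Proof.
move=> J0 L0; have iE := ext_ideal (@embed_x K n m) (@embed_y K n m).
apply/seteqP; split.
  move=> _ [i [j [Ii Jj ->]]]; apply: (idealD (iE _ _)).
    move: Ii; apply: gen_mono => q [|[_ -> <-]]; first by left.
    by right; exists 0.
  move: Jj; apply: gen_mono => q [[_ -> <-]|]; last by right.
  by left; exists 0.
apply: gen_sub; first exact: ideal_add_ideal (iE _ _) (iE _ _).
move=> q [Jq|Lq].
  exists q, 0; split; [by apply: mem_ideal_gen; left | exact: ideal0 (iE _ _) | by rewrite addr0].
exists 0, q; split; [exact: ideal0 (iE _ _) | by apply: mem_ideal_gen; right | by rewrite add0r].
Qed.

(** Apply [depth_setI] to the two extended ideals: their sum has depth [d1 + d2],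
    they have depths [d1 + m] and [n + d2], and [d1 < n], [d2 < m] because both
    ideals are nonzero. *)
Lemma depth_prodm U V d1 d2 : upset U -> upset V ->
  (exists u, U u) -> (exists v, V v) ->
  (forall u, U u -> u != 0%MM) -> (forall v, V v -> v != 0%MM) ->
  depth_is (@max_ideal K n) d1 (mon U) ->
  depth_is (@max_ideal K m) d2 (mon V) ->
  depth_is (@max_ideal K (n + m)) (d1 + d2).+1 (mon (prodm U V) : set S).
Proof.
move=> upU upV [u Uu] [v Vv] U0 V0 dU dV.
have iU := mon_ideal K upU; have iV := mon_ideal K upV.
have lt1 : (d1 < n)%N.
  apply: (depth_lt_dim (@max_ideal_proper K n) iU _ (@max_ideal_ideal K n) dU (h := 'X_[u])).
  - by rewrite max_idealE => p Up w /Up /U0.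
  - exact/monX.
  - by rewrite -msize_poly_eq0 msizeX.
have lt2 : (d2 < m)%N.
  apply: (depth_lt_dim (@max_ideal_proper K m) iV _ (@max_ideal_ideal K m) dV (h := 'X_[v])).
  - by rewrite max_idealE => p Vp w /Vp /V0.
  - exact/monX.
  - by rewrite -msize_poly_eq0 msizeX.
have tens r q J L : is_ideal J -> is_ideal L ->
    depth_is (@max_ideal K n) r J -> depth_is (@max_ideal K m) q L ->
    depth_is (@max_ideal K (n + m)) (r + q) (extxy J L).
  rewrite -ext_max; apply: depth_tensor.
  - exact: embed_spanned.
  - exact: embedC.
  - exact: embed_contract_y.
  - exact: embed_contract_x.
have dI := tens _ _ _ _ iU (zero_ideal _) dU (@depth_mpoly K m).
have dJ := tens _ _ _ _ (zero_ideal _) iV (@depth_mpoly K n) dV.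
rewrite mon_prodm -ext_mon0 // -ext_0mon //.
apply: (depth_setI (@mpoly_noetherian K _) (@max_ideal_ideal K _) _ _ _ dI dJ).
- exact: ext_ideal.
- exact: ext_ideal.
- by rewrite ext_ideal_add; [exact: tens | exact: ideal0 iU | exact: ideal0 iV].
- by rewrite ltn_add2l.
- by rewrite ltn_add2r.
Qed.

Lemma indeg_prodm U V : upset U -> upset V ->
  (exists u, U u) -> (exists v, V v) ->
  indeg (mon (prodm U V) : set S) =
  (indeg (mon U : set {mpoly K[n]}) + indeg (mon V : set {mpoly K[m]}))%N.
Proof.
move=> upU upV /min_mdeg_ex [u Uu minu] /min_mdeg_ex [v Vv minv].
rewrite (indegE K upU Uu minu) (indegE K upV Vv minv) -mdeg_mxy.
apply: indegE; first exact: prodm_upset.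
  by rewrite /prodm /= mnx_mxy mny_mxy.
by move=> w [/minu Uw /minv Vw]; rewrite -[w]mxyK !mdeg_mxy leq_add.
Qed.

End Product.

Theorem theorem2p1 (K : fieldType) (n m : nat)
    (I1 : set {mpoly K[n]}) (I2 : set {mpoly K[m]})
    (sqfI1 : squarefree_monomial_ideal I1)
    (sqfI2 : squarefree_monomial_ideal I2)
    (suppI1 : full_support I1) (suppI2 : full_support I2) :
  monomial_grade (disjoint_mul I1 I2)
    = minn (monomial_grade I1) (monomial_grade I2)
  /\ forall k : nat,
       (1 <= k <= monomial_grade (disjoint_mul I1 I2))%N ->
       norm_depth (disjoint_mul I1 I2) k = norm_depth I1 k + norm_depth I2 k.
Proof.
have [U [gU -> neU]] := sqfree_idealP sqfI1.
have [V [gV -> neV]] := sqfree_idealP sqfI2.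
have [upU nU0 _] := gU; have [upV nV0 _] := gV.
rewrite disjoint_mul_mon //.
have gUV := sqfree_gen_prod gU gV.
have gradeP k : (k <= monomial_grade (mon (prodm U V) : set {mpoly K[n + m]}))%N =
    (k <= minn (monomial_grade (mon U : set {mpoly K[n]}))
               (monomial_grade (mon V : set {mpoly K[m]})))%N.
  rewrite leq_min; apply/idP/andP => [/(monomial_gradeP _ _ gUV) /sqfree_powmP [w]|].
    rewrite sqfree_powm_prod => -[Uw Vw].
    by split; apply/monomial_gradeP => //; apply/sqfree_powmP;
      [exists (mnx w) | exists (mny w)].
  move=> [/(monomial_gradeP _ _ gU) /sqfree_powmP [a Ua] /(monomial_gradeP _ _ gV) /sqfree_powmP [b Vb]].
  apply/monomial_gradeP => //; apply/sqfree_powmP; exists (mxy a b).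
  by rewrite sqfree_powm_prod /prodm /= mnx_mxy mny_mxy.
split; first by apply/eqP; rewrite eqn_leq -gradeP leqnn gradeP leqnn.
move=> k /andP[k0]; rewrite gradeP leq_min => /andP[].
move=> /(monomial_gradeP _ _ gU) /sqfree_powmP neUk /(monomial_gradeP _ _ gV) /sqfree_powmP neVk.
rewrite /norm_depth !mon_sqfree_powm sqfree_powm_prod.
have upUk := @sqfree_powm_upset n U k; have upVk := @sqfree_powm_upset m V k.
have U0 u : sqfree_powm U k u -> u != 0%MM by apply: sqfree_powm_nonzero.
have V0 v : sqfree_powm V k v -> v != 0%MM by apply: sqfree_powm_nonzero.
have depth_ex l (W : set 'X_{1..l}) : upset W -> (forall u, W u -> u != 0%MM) ->
    exists2 r, depth_is (@max_ideal K l) r (mon W) & depth_quot (mon W : set {mpoly K[l]}) = r.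
  move=> upW W0; have sub : mon W `<=` @max_ideal K l.
    by rewrite max_idealE => p Wp w /Wp /W0.
  have [r dr] := depth_is_ex (@mpoly_noetherian K l) (@max_ideal_ideal K l)
    (@max_ideal_proper K l) (mon_ideal K upW) sub.
  by exists r => //; apply: depth_quotE => //; apply: mon_ideal.
have [d1 dU ->] := depth_ex _ _ upUk U0.
have [d2 dV ->] := depth_ex _ _ upVk V0.
have -> : depth_quot (mon (prodm (sqfree_powm U k) (sqfree_powm V k)) : set {mpoly K[n + m]}) = (d1 + d2).+1.
  have [||r dr ->] := depth_ex _ (prodm (sqfree_powm U k) (sqfree_powm V k)).
  - exact: prodm_upset.
  - move=> w [/U0 + _]; apply: contraNneq => ->.
    by apply/eqP/mnmP => i; rewrite !mnmE.
  apply: (depth_is_inj (@mpoly_noetherian K _) (@max_ideal_ideal K _) _ dr).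
    by apply: mon_ideal; apply: prodm_upset.
  exact: depth_prodm.
rewrite indeg_prodm //.
by rewrite -addn1 !PoszD; ring.
Qed.
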